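(* Fix an LCSTRS $\mathcal{R}$ (with a sort ordering, with respect to which computability is taken). Then each of the following kinds of DP processors is sound: graph processors; subterm criterion processors; integer mapping processors (under the assumptions stated for them); theory argument processors; and reduction pair processors.
   Context: LCSTRSs. Fix a non-empty set $\mathcal{S}$ of sorts and a subset $\mathcal{S}_{\mathrm{th}}\subseteq\mathcal{S}$ of theory sorts. Types are generated by $\mathcal{T}::=\mathcal{S}\mid(\mathcal{T}\to\mathcal{T})$; theory types by $\mathcal{T}_{\mathrm{th}}::=\mathcal{S}_{\mathrm{th}}\mid(\mathcal{S}_{\mathrm{th}}\to\mathcal{T}_{\mathrm{th}})$. Given disjoint sets $\mathcal{F}$ (function symbols) and $\mathcal{V}$ (variables), each with a unique type and infinitely many variables per type, terms are well-typed expressions built from symbols, variables and application $t_0\,t_1$ (left-associative). $\mathrm{FV}(t)$ is the set of variables of $t$; ground means $\mathrm{FV}(t)=\emptyset$. Theory symbols $\mathcal{F}_{\mathrm{th}}\subseteq\mathcal{F}$ have theory types; those of sort type are values; terms over theory symbols and variables are theory terms; $T(\mathcal{F}_{\mathrm{th}},L)$ denotes theory terms with variables in $L$. Each theory sort $A$ has a set $\mathfrak{X}_A$ ($\mathfrak{X}_{A\to B}$ = maps), and $[\![\cdot]\!]$ interprets theory symbols (bijectively on values of each theory sort), extended to ground theory terms by $[\![t_0\,t_1]\!]=[\![t_0]\!]([\![t_1]\!])$. $\mathsf{bool}\in\mathcal{S}_{\mathrm{th}}$, $\mathfrak{X}_{\mathsf{bool}}=\{0,1\}$, values $\mathfrak{t},\mathfrak{f}$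 interpreted as $1,0$. A logical constraint is a theory term of type $\mathsf{bool}$ whose variables have theory sorts. Substitutions are type-preserving maps from variables to terms ($t\sigma$). Contexts $C[\,]$ have exactly one hole. A pattern is a term each of whose subterms is a variable or $f\,t_1\cdots t_n$ with $f\in\mathcal{F}$. A rule $\ell\to r\ [\varphi]$: $\ell,r$ same type, $\varphi$ a logical constraint, variables of $\mathrm{FV}(r)\setminus\mathrm{FV}(\ell)$ of theory sorts, $\ell=f\,t_1\cdots t_n$ a pattern containing a symbol of $\mathcal{F}\setminus\mathcal{F}_{\mathrm{th}}$. $\sigma$ respects it if $\sigma(x)$ is a value for $x\in\mathrm{FV}(\varphi)\cup(\mathrm{FV}(r)\setminus\mathrm{FV}(\ell))$ and $[\![\varphi\sigma]\!]=1$. The LCSTRS $\mathcal{R}$ is a set of rules; $\to_{\mathcal{R}}$ consists of $C[\ell\sigma]\to C[r\sigma]$ (rule, respecting $\sigma$) and calculation steps $C[f\,v_1\cdots v_n]\to_\kappa C[v']$ ($f$ theory symbol, $n>0$, values $v_i,v'$, $[\![f\,v_1\cdots v_n]\!]=[\![v']\!]$), the latter also forming $\to_\kappa$. $t{\downarrow_\kappa}$ is the unique $\to_\kappa$-normal form of $t$. Defined symbols $\mathcal{D}$: heads of left-hand sides. $s\trianglerighteq t$ iff $s=t$, or $s=s_0\,s_1$ with $s_1\trianglerighteq t$, or $s=s_0\,s_1$ with $s_0\trianglerighteq t$, $s_0\neq t$; $\triangleright$ is its strict part. A relation $\sqsupseteq$ is monotonic if $s\sqsupseteq t$ implies $C[s]\sqsupseteq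 C[t]$. Computability. A sort ordering is a quasi-order $\succsim$ on sorts with well-founded strict part $\succ$. For a sort $A$ and $B=B_1\to\cdots\to B_n\to C$: $A\succsim_+B$ iff $A\succsim C$ and $A\succ_-B_i$ for all $i$; $A\succ_-B$ iff $A\succ C$ and $A\succsim_+B_i$ for all $i$. $\mathrm{Acc}(f)=\{i:B\succsim_+A_i\}$ for $f:A_1\to\cdots\to A_n\to B$. An RC-set is a sort-indexed family $(I_A)$ of sets of terminating terms of type $A$, closed under $\to_{\mathcal{R}}$, and containing every neutral term $x\,t_1\cdots t_n$ of type $A$ all of whose reducts are in $I_A$. $t$ is $I$-computable if of sort type and in $I$, or of type $A\to B$ with $t\,u$ $I$-computable for all $I$-computable $u:A$. $s\Rrightarrow_It$ iff both have base type, $s=f\,s_1\cdots s_m$, $t=s_k\,t_1\cdots t_n$ with $k\in\mathrm{Acc}(f)$ and all $t_i$ $I$-computable. $\mathbb{C}$ is the (known to exist) RC-set with: $t\in\mathbb{C}_A$ iff $t:A$ terminates w.r.t. $\to_{\mathcal{R}}\cup\Rrightarrow_{\mathbb{C}}$ and every $t'=f\,t_1\cdots t_n$ with $t\to_{\mathcal{R}}^*t'$ has $t_i$ $\mathbb{C}$-computable for $i\in\mathrm{Acc}(f)$. Computable means $\mathbb{C}$-computable. SDPs and chains. Fresh sort $\mathsf{dp}$; for $f\in\mathcal{D}$, $f:A_1\to\cdots\to A_n\to B$ ($B$ sort), fresh $f^\sharp:A_1\to\cdots\to A_n\to\mathsf{dp}$. An SDP is $s^\sharp\Rightarrow t^\sharp\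 [\varphi\mid L]$ with $s^\sharp,t^\sharp:\mathsf{dp}$ headed by marked symbols, $\varphi$ a logical constraint, $L\supseteq\mathrm{FV}(\varphi)$ a set of variables of theory sorts. $\sigma$ respects it if $\sigma(x)$ is a ground theory term for $x\in L$ and $[\![\varphi\sigma]\!]=1$. A $(\mathcal{P},\mathcal{R})$-chain is a finite or infinite sequence $(p_i,\sigma_i)$ with $p_i=s_i^\sharp\Rightarrow t_i^\sharp\ [\varphi_i\mid L_i]\in\mathcal{P}$, $\sigma_i$ respecting $p_i$, $t_{i-1}^\sharp\sigma_{i-1}\to_{\mathcal{R}}^*s_i^\sharp\sigma_i$ for $i>0$; it is computable if $u\sigma_i$ is computable whenever $t_i\triangleright u$ ($t_i$ = $t_i^\sharp$ with head unmarked). DP framework. A DP problem is a set $\mathcal{P}$ of SDPs; it is finite if there is no infinite computable $(\mathcal{P},\mathcal{R})$-chain. A DP processor is a partial map assigning to a DP problem a set of DP problems; it is sound if $\mathcal{P}$ is finite whenever all problems in $\rho(\mathcal{P})$ are finite. (1) A graph approximation $(G_\theta,\theta)$ for $\mathcal{P}$ is a finite directed graph $G_\theta$ with a map $\theta$ from $\mathcal{P}$ to its vertices such that there is an edge from $\theta(p_0)$ to $\theta(p_1)$ whenever $(p_0,\sigma_0),(p_1,\sigma_1)$ is a $(\mathcal{P},\mathcal{R})$-chain for some $\sigma_0,\sigma_1$. A graph processor computes a graph approximation and returns $\{\{p\in\mathcal{P}:\theta(p)\in S\}: S$ a non-trivial strongly connected component of $G_\theta\}$. (2) $\mathrm{Head}(\mathcal{P})$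 is the set of symbols heading either side of an SDP in $\mathcal{P}$. A projection $\nu$ maps each $f^\sharp\in\mathrm{Head}(\mathcal{P})$, $f^\sharp:A_1\to\cdots\to A_n\to\mathsf{dp}$, to an integer in $\{1,\dots,n\}$; $\bar\nu(f^\sharp\,t_1\cdots t_n)=t_{\nu(f^\sharp)}$. $\nu$ $\triangleright$-orients $\mathcal{P}'\subseteq\mathcal{P}$ if $\bar\nu(s^\sharp)\triangleright\bar\nu(t^\sharp)$ for all SDPs in $\mathcal{P}'$ and $\bar\nu(s^\sharp)=\bar\nu(t^\sharp)$ for those in $\mathcal{P}\setminus\mathcal{P}'$. A subterm criterion processor maps $\mathcal{P}$ to $\{\mathcal{P}\setminus\mathcal{P}'\}$ for some non-empty $\mathcal{P}'$ that is $\triangleright$-oriented by some projection. (3) Assume $\mathsf{int}\in\mathcal{S}_{\mathrm{th}}$ and $\ge,>:\mathsf{int}\to\mathsf{int}\to\mathsf{bool}$, $\wedge:\mathsf{bool}\to\mathsf{bool}\to\mathsf{bool}$ are theory symbols with standard interpretation. For $f^\sharp\in\mathrm{Head}(\mathcal{P})$, $f^\sharp:A_1\to\cdots\to A_n\to\mathsf{dp}$, $\mathrm{FI}(f^\sharp)$ is the set of $i$ with $A_i\in\mathcal{S}_{\mathrm{th}}$ such that the $i$-th argument of every occurrence of $f^\sharp$ in any SDP $s^\sharp\Rightarrow t^\sharp\ [\varphi\mid L]\in\mathcal{P}$ lies in $T(\mathcal{F}_{\mathrm{th}},L)$; let $x_{f^\sharp,i}:A_i$ ($i\in\mathrm{FI}(f^\sharp)$)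 be fresh variables. An integer mapping $\mathcal{J}$ assigns each $f^\sharp$ a theory term of type $\mathsf{int}$ with variables among the $x_{f^\sharp,i}$; $\bar{\mathcal{J}}(f^\sharp\,t_1\cdots t_n)=\mathcal{J}(f^\sharp)[x_{f^\sharp,i}:=t_i]_{i\in\mathrm{FI}(f^\sharp)}$. Write $\varphi\models\varphi'$ if $[\![\varphi\sigma]\!]=1$ implies $[\![\varphi'\sigma]\!]=1$ for every $\sigma$ mapping the variables of $\varphi,\varphi'$ to values. $\mathcal{J}$ $>$-orients $\mathcal{P}'\subseteq\mathcal{P}$ if $\varphi\models\bar{\mathcal{J}}(s^\sharp)\ge0\wedge\bar{\mathcal{J}}(s^\sharp)>\bar{\mathcal{J}}(t^\sharp)$ for all SDPs of $\mathcal{P}'$ and $\varphi\models\bar{\mathcal{J}}(s^\sharp)\ge\bar{\mathcal{J}}(t^\sharp)$ for those of $\mathcal{P}\setminus\mathcal{P}'$. An integer mapping processor maps $\mathcal{P}$ to $\{\mathcal{P}\setminus\mathcal{P}'\}$ for some non-empty $\mathcal{P}'$ $>$-oriented by some integer mapping. (4) A theory argument mapping $\tau$ maps each $f^\sharp\in\mathrm{Head}(\mathcal{P})$, $f^\sharp:A_1\to\cdots\to A_m\to\mathsf{dp}$, to a subset of $\{i:A_i\in\mathcal{S}_{\mathrm{th}}\}$ such that for every $f^\sharp\,s_1\cdots s_m\Rightarrow t^\sharp\ [\varphi\mid L]\in\mathcal{P}$ and $i\in\tau(f^\sharp)$, $s_i$ is a theory term whose variables all have theory sorts, and for every $f^\sharp\,s_1\cdots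 s_m\Rightarrow g^\sharp\,t_1\cdots t_n\ [\varphi\mid L]\in\mathcal{P}$ and $j\in\tau(g^\sharp)$, $t_j$ is a theory term with $\mathrm{FV}(t_j)\subseteq L\cup\bigcup_{i\in\tau(f^\sharp)}\mathrm{FV}(s_i)$. $\bar\tau(f^\sharp\,s_1\cdots s_m\Rightarrow t^\sharp\ [\varphi\mid L])=f^\sharp\,s_1\cdots s_m\Rightarrow t^\sharp\ [\varphi\mid L\cup\bigcup_{i\in\tau(f^\sharp)}\mathrm{FV}(s_i)]$. $\tau$ fixes $\mathcal{P}'\subseteq\mathcal{P}$ if $\bigcup_{i\in\tau(f^\sharp)}\mathrm{FV}(t_i)\subseteq L$ for all $s^\sharp\Rightarrow f^\sharp\,t_1\cdots t_n\ [\varphi\mid L]\in\mathcal{P}'$. A theory argument processor maps $\mathcal{P}$ to $\{\{\bar\tau(p):p\in\mathcal{P}\},\mathcal{P}\setminus\mathcal{P}'\}$ for some non-empty $\mathcal{P}'$ fixed by some theory argument mapping $\tau$. (5) A constrained relation $R$ is a set of quadruples $(s,t,\varphi,L)$ ($s,t$ same type, $\varphi$ a logical constraint, $L\supseteq\mathrm{FV}(\varphi)$ theory-sorted variables), written $s\,R\,t\ [\varphi\mid L]$. A binary relation $R'$ on terms covers $R$ if $s\,R\,t\ [\varphi\mid L]$ implies $(s\sigma){\downarrow_\kappa}\,R'\,(t\sigma){\downarrow_\kappa}$ for every $\sigma$ with $\sigma(x)$ a ground theory term for $x\in L$ and $[\![\varphi\sigma]\!]=1$. A constrained reduction pair $(\succeq,\succ)$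 is a pair of constrained relations such that $\succeq$ is covered by a reflexive monotonic relation $\sqsupseteq$ containing $\to_\kappa$, $\succ$ is covered by a well-founded relation $\sqsupset$, and $s\sqsupseteq t\sqsupset u$ implies $s\sqsupset^+u$. A reduction pair processor maps $\mathcal{P}$ to $\{\mathcal{P}\setminus\mathcal{P}'\}$ for some non-empty $\mathcal{P}'$ for which there is a constrained reduction pair with $s^\sharp\succ t^\sharp\ [\varphi\mid L]$ for all SDPs in $\mathcal{P}'$, $s^\sharp\succeq t^\sharp\ [\varphi\mid L]$ for all SDPs in $\mathcal{P}\setminus\mathcal{P}'$, and $\ell\succeq r\ [\varphi\mid\mathrm{FV}(\varphi)\cup(\mathrm{FV}(r)\setminus\mathrm{FV}(\ell))]$ for all rules $\ell\to r\ [\varphi]\in\mathcal{R}$. *)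

(* Defs.v *)
From Stdlib Require List.
From Stdlib Require Import Relations.
From mathcomp Require Import all_boot all_order all_algebra.
From mathcomp Require Import boolp classical_sets cardinality.

Set Implicit Arguments.
Unset Strict Implicit.
Unset Printing Implicit Defensive.

Import Order.TTheory GRing.Theory Num.Theory.
Local Open Scope classical_set_scope.

Inductive ty (S : Type) : Type := Base of S | Arr of ty S & ty S.

Fixpoint args S (A : ty S) : seq (ty S) :=
  if A is Arr B C then B :: args C else [::].

Fixpoint target S (A : ty S) : S :=
  match A with Base B => B | Arr _ C => target C end.

Fixpoint carrier S (dom : S -> Type) (A : ty S) : Type :=
  match A with Base B => dom B | Arr B C => carrier dom B -> carrier dom C end.

Fixpoint theory_type S (th : pred S) (A : ty S) : bool :=
  match A with
  | Base B => th B
  | Arr (Base B) C => th B && theory_type th C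
  | Arr _ _ => false
  end.

(* [dom] is only meaningful on theory sorts.  [interp_bij] says that, for each
   theory sort, interpretation is a bijection from its values onto its domain;
   [truth] identifies the domain of the sort bool with {0, 1}. *)
Record signature := Signature {
  sort_of : Type;
  thsort : pred sort_of;
  fsym : Type;
  ftype : fsym -> ty sort_of;
  var : Type;
  vtype : var -> ty sort_of;
  var_infinite : forall A, infinite_set [set x | vtype x = A];
  thsym : pred fsym;
  thsym_type : forall f, thsym f -> theory_type thsort (ftype f);
  dom : sort_of -> Type;
  interp : forall f, thsym f -> carrier dom (ftype f);
  interp_bij : forall A, thsort A -> forall a : dom A,
    exists! f, exists h : thsym f,
      existT (carrier dom) (ftype f) (interp h) =
      existT (carrier dom) (Base A) a;
  boolsort : sort_of;
  boolsort_th : thsort boolsort;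
  truth : dom boolsort -> bool;
  truth_bij : bijective truth
}.

Section LCSTRS.
Context {sg : signature}.
Local Notation sort := (sort_of sg).
Local Notation fsym := (fsym sg).
Local Notation var := (var sg).
Local Notation carrier := (carrier (@dom sg)).

(* [Mark f] is the marked symbol of [f]. *)
Inductive term : Type :=
| Fun of fsym
| Mark of fsym
| Var of var
| App of term & term.

Definition apps (t : term) (ts : seq term) : term := foldl App t ts.

(* Terms are typed over the sorts extended with the fresh sort dp. *)
Definition dp : option sort := None.

Fixpoint lift (A : ty sort) : ty (option sort) :=
  match A with Base B => Base (Some B) | Arr B C => Arr (lift B) (lift C) end.

Fixpoint sharp (A : ty sort) : ty (option sort) :=
  match A with Base _ => Base dp | Arr B C => Arr (lift B) (sharp C) end.

(* Typing of terms whose marked symbols come from [M].  No symbol or variable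
   has an argument type involving dp, so marked symbols only occur as heads, and
   a term of type [lift A] contains none. *)
Inductive typed (M : set fsym) : term -> ty (option sort) -> Prop :=
| typed_fun f : typed M (Fun f) (lift (ftype f))
| typed_mark f : M f -> typed M (Mark f) (sharp (ftype f))
| typed_var x : typed M (Var x) (lift (vtype x))
| typed_app s t A B :
    typed M s (Arr A B) -> typed M t A -> typed M (App s t) B.

Definition has_type (t : term) (A : ty sort) : Prop := typed set0 t (lift A).

Fixpoint FV (t : term) : set var :=
  match t with
  | Fun _ | Mark _ => set0
  | Var x => [set x]
  | App s u => FV s `|` FV u
  end.

Fixpoint theory_term (t : term) : Prop :=
  match t with
  | Fun f => thsym f
  | Mark _ => False
  | Var _ => True
  | App s u => theory_term s /\ theory_term u
  end.

Definition ground_theory_term (t : term) : Prop :=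
  theory_term t /\ FV t = set0.

Definition value (t : term) : Prop :=
  exists f A, [/\ t = Fun f, thsym f & ftype f = Base A].

Definition theory_sorted (x : var) : Prop :=
  exists2 A, thsort A & vtype x = Base A.

Definition interp_as (f : fsym) (A : ty sort) (a : carrier A) : Prop :=
  exists h : thsym f,
    existT carrier (ftype f) (interp h) = existT carrier A a.

(* The graph of the interpretation of ground theory terms. *)
Inductive denote : term -> forall A : ty sort, carrier A -> Prop :=
| denote_fun f A (a : carrier A) : interp_as f a -> denote (Fun f) a
| denote_app s t A B (g : carrier (Arr A B)) (a : carrier A) :
    denote s g -> denote t a -> @denote (App s t) B (g a).

Definition holds (t : term) : Prop :=
  exists2 b : dom (boolsort sg), @denote t (Base (boolsort sg)) b & truth b.

Definition logical_constraint (phi : term) : Prop :=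
  [/\ has_type phi (Base (boolsort sg)), theory_term phi
    & FV phi `<=` theory_sorted].

Fixpoint subst (sigma : var -> term) (t : term) : term :=
  match t with
  | Fun f => Fun f
  | Mark f => Mark f
  | Var x => sigma x
  | App s u => App (subst sigma s) (subst sigma u)
  end.

Definition substitution (sigma : var -> term) : Prop :=
  forall x, has_type (sigma x) (vtype x).

Inductive context : Type :=
| Hole
| CAppl of context & term
| CAppr of term & context.

Fixpoint fill (C : context) (t : term) : term :=
  match C with
  | Hole => t
  | CAppl D u => App (fill D t) u
  | CAppr u D => App u (fill D t)
  end.

Inductive subterm : term -> term -> Prop :=
| subterm_refl s : subterm s s
| subterm_r s0 s1 t : subterm s1 t -> subterm (App s0 s1) t
| subterm_l s0 s1 t : subterm s0 t -> s0 <> t -> subterm (App s0 s1) t.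

Definition strict_subterm (s t : term) : Prop :=
  subterm s t /\ ~ subterm t s.

Definition pattern (t : term) : Prop :=
  forall u, subterm t u ->
    (exists x, u = Var x) \/ (exists f ts, u = apps (Fun f) ts).

Record rule : Type := Rule { lhs : term; rhs : term; guard : term }.

Definition is_rule (rho : rule) : Prop :=
  [/\ exists A, has_type (lhs rho) A /\ has_type (rhs rho) A,
      logical_constraint (guard rho),
      FV (rhs rho) `\` FV (lhs rho) `<=` theory_sorted,
      pattern (lhs rho) /\ (exists f ts, lhs rho = apps (Fun f) ts)
    & exists C f, lhs rho = fill C (Fun f) /\ ~~ thsym f].

Definition lcstrs (R : set rule) : Prop := R `<=` is_rule.

(* FV(phi) together with FV(r) \ FV(l). *)
Definition rule_lvars (rho : rule) : set var :=
  FV (guard rho) `|` (FV (rhs rho) `\` FV (lhs rho)).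

Definition respects_rule (sigma : var -> term) (rho : rule) : Prop :=
  (forall x, rule_lvars rho x -> value (sigma x)) /\
  holds (subst sigma (guard rho)).

Inductive calc : term -> term -> Prop :=
| calc_step C f vs v A (a : carrier A) :
    thsym f -> vs <> [::] -> List.Forall value vs -> value v ->
    denote (apps (Fun f) vs) a -> denote v a ->
    calc (fill C (apps (Fun f) vs)) (fill C v).

Definition calc_nf (t u : term) : Prop :=
  clos_refl_trans term calc t u /\ forall u', ~ calc u u'.

Definition terminating (r : term -> term -> Prop) (t : term) : Prop :=
  Acc (fun v u => r u v) t.

Section System.
Variable R : set rule.

Inductive step : term -> term -> Prop :=
| step_rule C rho sigma :
    R rho -> substitution sigma -> respects_rule sigma rho ->
    step (fill C (subst sigma (lhs rho))) (fill C (subst sigma (rhs rho)))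
| step_calc s t : calc s t -> step s t.

Definition steps : term -> term -> Prop := clos_refl_trans term step.

Definition defined : set fsym :=
  [set f | exists2 rho, R rho & exists ts, lhs rho = apps (Fun f) ts].

Definition has_xtype (t : term) (A : ty (option sort)) : Prop :=
  typed defined t A.

Definition xterm (t : term) : Prop := exists A, has_xtype t A.

Section Computability.
Variable ge : sort -> sort -> Prop.

Definition sort_gt (A B : sort) : Prop := ge A B /\ ~ ge B A.

Definition sort_ordering : Prop :=
  [/\ forall A, ge A A,
      forall A B D, ge A B -> ge B D -> ge A D
    & well_founded (fun A B => sort_gt B A)].

Fixpoint ge_pos (A : sort) (B : ty sort) : Prop :=
  match B with
  | Base D => ge A D
  | Arr B1 B2 => gt_neg A B1 /\ ge_pos A B2
  end
with gt_neg (A : sort) (B : ty sort) : Prop :=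
  match B with
  | Base D => sort_gt A D
  | Arr B1 B2 => ge_pos A B1 /\ gt_neg A B2
  end.

(* Argument positions are numbered from 0, here and below. *)
Definition accessible (f : fsym) : set nat :=
  [set i | exists2 A, onth (args (ftype f)) i = Some A
                    & ge_pos (target (ftype f)) A].

Definition rc_set (I : sort -> set term) : Prop :=
  [/\ forall A t, I A t -> has_type t (Base A) /\ terminating step t,
      forall A t t', I A t -> step t t' -> I A t'
    & forall A x ts, has_type (apps (Var x) ts) (Base A) ->
        (forall t', step (apps (Var x) ts) t' -> I A t') ->
        I A (apps (Var x) ts)].

Fixpoint computable_at (I : sort -> set term) (A : ty sort) (t : term) : Prop :=
  match A with
  | Base B => I B t
  | Arr B D => has_type t (Arr B D) /\
      forall u, computable_at I B u -> computable_at I D (App t u)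
  end.

Definition computable (I : sort -> set term) (t : term) : Prop :=
  exists A, computable_at I A t.

Definition acc_step (I : sort -> set term) (s t : term) : Prop :=
  [/\ exists A, has_type s (Base A),
      exists B, has_type t (Base B)
    & exists f ss k u ts,
        [/\ s = apps (Fun f) ss, accessible f k, onth ss k = Some u,
            t = apps u ts & List.Forall (computable I) ts]].

Definition computability_rc_set (I : sort -> set term) : Prop :=
  rc_set I /\
  forall A t, I A t <->
    [/\ has_type t (Base A),
        terminating (fun u v => step u v \/ acc_step I u v) t
      & forall f ts, steps t (apps (Fun f) ts) ->
          forall i u, accessible f i -> onth ts i = Some u -> computable I u].

End Computability.

(* The SDP  Mark sdp_f sdp_ss => Mark sdp_g sdp_ts [sdp_phi | sdp_L]. *)
Record sdp : Type := Sdp {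
  sdp_f : fsym;
  sdp_ss : seq term;
  sdp_g : fsym;
  sdp_ts : seq term;
  sdp_phi : term;
  sdp_L : set var
}.

Definition sdp_lhs (p : sdp) : term := apps (Mark (sdp_f p)) (sdp_ss p).
Definition sdp_rhs (p : sdp) : term := apps (Mark (sdp_g p)) (sdp_ts p).
Definition sdp_rhs_unmarked (p : sdp) : term :=
  apps (Fun (sdp_g p)) (sdp_ts p).

Definition is_sdp (p : sdp) : Prop :=
  [/\ has_xtype (sdp_lhs p) (Base dp), has_xtype (sdp_rhs p) (Base dp),
      logical_constraint (sdp_phi p), FV (sdp_phi p) `<=` sdp_L p
    & sdp_L p `<=` theory_sorted].

Definition respects (sigma : var -> term) (phi : term) (L : set var) : Prop :=
  (forall x, L x -> ground_theory_term (sigma x)) /\ holds (subst sigma phi).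

(* [None] is the length of infinite sequences; entries of [c] beyond the length
   are irrelevant. *)
Definition below (len : option nat) (i : nat) : bool :=
  if len is Some n then i < n else true.

Definition chain (P : set sdp) (len : option nat)
    (c : nat -> sdp * (var -> term)) : Prop :=
  (forall i, below len i ->
     [/\ P (c i).1, substitution (c i).2
       & respects (c i).2 (sdp_phi (c i).1) (sdp_L (c i).1)]) /\
  (forall i, below len i.+1 ->
     steps (subst (c i).2 (sdp_rhs (c i).1))
           (subst (c i.+1).2 (sdp_lhs (c i.+1).1))).

Definition computable_chain (I : sort -> set term) (P : set sdp)
    (len : option nat) (c : nat -> sdp * (var -> term)) : Prop :=
  chain P len c /\
  forall i u, below len i -> strict_subterm (sdp_rhs_unmarked (c i).1) u ->
    computable I (subst (c i).2 u).

Definition dp_problem (P : set sdp) : Prop := P `<=` is_sdp.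

Definition dp_finite (I : sort -> set term) (P : set sdp) : Prop :=
  ~ exists c, computable_chain I P None c.

Definition processor : Type := set sdp -> option (set (set sdp)).

Definition sound (I : sort -> set term) (proc : processor) : Prop :=
  forall P Q, dp_problem P -> proc P = Some Q ->
    (forall P', Q P' -> dp_finite I P') -> dp_finite I P.

(* Values of [theta] outside [P] are irrelevant. *)
Definition graph_approximation (P : set sdp) (V : finType) (edge : rel V)
    (theta : sdp -> V) : Prop :=
  forall p0 p1 sigma0 sigma1,
    chain P (Some 2)
      (fun i => if i is 0 then (p0, sigma0) else (p1, sigma1)) ->
    edge (theta p0) (theta p1).

Definition scc (V : finType) (edge : rel V) (S : {set V}) : Prop :=
  exists v, S = [set w | connect edge v w && connect edge w v]%SET.

(* A single vertex is a non-trivial component when it carries a loop. *)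
Definition nontrivial (V : finType) (edge : rel V) (S : {set V}) : Prop :=
  exists v w, [/\ v \in S, w \in S & edge v w].

Definition graph_processor (proc : processor) : Prop :=
  forall P Q, dp_problem P -> proc P = Some Q ->
    exists (V : finType) (edge : rel V) (theta : sdp -> V),
      graph_approximation P edge theta /\
      Q = [set P' | exists S : {set V},
            [/\ scc edge S, nontrivial edge S
              & P' = [set p | P p /\ theta p \in S]]].

Definition heads (P : set sdp) : set fsym :=
  [set f | exists2 p, P p & f = sdp_f p \/ f = sdp_g p].

Definition projection (P : set sdp) (nu : fsym -> nat) : Prop :=
  forall f, heads P f -> nu f < size (args (ftype f)).

Definition subterm_orients (P P' : set sdp) (nu : fsym -> nat) : Prop :=
  (forall p, P' p -> exists u v,
     [/\ onth (sdp_ss p) (nu (sdp_f p)) = Some u,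
         onth (sdp_ts p) (nu (sdp_g p)) = Some v & strict_subterm u v]) /\
  (forall p, (P `\` P') p -> exists u,
     onth (sdp_ss p) (nu (sdp_f p)) = Some u /\
     onth (sdp_ts p) (nu (sdp_g p)) = Some u).

Definition subterm_criterion_processor (proc : processor) : Prop :=
  forall P Q, dp_problem P -> proc P = Some Q ->
    exists P' nu,
      [/\ P' `<=` P, P' !=set0, projection P nu, subterm_orients P P' nu
        & Q = [set P `\` P']].

End System.

Record int_theory := IntTheory {
  intsort : sort;
  intsort_th : thsort intsort;
  toint : dom intsort -> int;
  toint_bij : bijective toint;
  zero_sym : fsym;
  geq_sym : fsym;
  gt_sym : fsym;
  and_sym : fsym;
  zero_symE : exists2 z : dom intsort,
    interp_as zero_sym (z : carrier (Base intsort)) & toint z = 0%R;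
  geq_symE : exists2 g : dom intsort -> dom intsort -> dom (boolsort sg),
    interp_as geq_sym
      (g : carrier (Arr (Base intsort)
             (Arr (Base intsort) (Base (boolsort sg)))))
    & forall a b, truth (g a b) = (toint b <= toint a)%R;
  gt_symE : exists2 g : dom intsort -> dom intsort -> dom (boolsort sg),
    interp_as gt_sym
      (g : carrier (Arr (Base intsort)
             (Arr (Base intsort) (Base (boolsort sg)))))
    & forall a b, truth (g a b) = (toint b < toint a)%R;
  and_symE : exists2 g : dom (boolsort sg) -> dom (boolsort sg) ->
                         dom (boolsort sg),
    interp_as and_sym
      (g : carrier (Arr (Base (boolsort sg))
             (Arr (Base (boolsort sg)) (Base (boolsort sg)))))
    & forall a b, truth (g a b) = truth a && truth b
}.

Definition geq_term (Z : int_theory) (s t : term) : term :=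
  apps (Fun (geq_sym Z)) [:: s; t].
Definition gt_term (Z : int_theory) (s t : term) : term :=
  apps (Fun (gt_sym Z)) [:: s; t].
Definition and_term (Z : int_theory) (s t : term) : term :=
  apps (Fun (and_sym Z)) [:: s; t].

Definition entails (phi psi : term) : Prop :=
  forall sigma, substitution sigma ->
    (forall x, (FV phi `|` FV psi) x -> value (sigma x)) ->
    holds (subst sigma phi) -> holds (subst sigma psi).

Definition theory_arg (f : fsym) : set nat :=
  [set i | exists2 A, thsort A & onth (args (ftype f)) i = Some (Base A)].

Definition FI (P : set sdp) (f : fsym) : set nat :=
  [set i | theory_arg f i /\ forall p u, P p ->
     (f = sdp_f p /\ onth (sdp_ss p) i = Some u) \/
     (f = sdp_g p /\ onth (sdp_ts p) i = Some u) ->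
     theory_term u /\ FV u `<=` sdp_L p].

(* [X f i] is the variable x_{f,i}.  Since the x_{f,i} are replaced
   simultaneously, only their distinctness for each given [f] matters. *)
Definition formal_vars (P : set sdp) (X : fsym -> nat -> var) : Prop :=
  forall f, heads P f ->
    (forall i, FI P f i -> onth (args (ftype f)) i = Some (vtype (X f i))) /\
    (forall i j, FI P f i -> FI P f j -> X f i = X f j -> i = j).

Definition integer_mapping (Z : int_theory) (P : set sdp)
    (X : fsym -> nat -> var) (J : fsym -> term) : Prop :=
  forall f, heads P f ->
    [/\ has_type (J f) (Base (intsort Z)), theory_term (J f)
      & FV (J f) `<=` [set X f i | i in FI P f]].

(* [int_value P X J f ts u] states u = J(f)[x_{f,i} := t_i]. *)
Definition int_value (P : set sdp) (X : fsym -> nat -> var) (J : fsym -> term)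
    (f : fsym) (ts : seq term) (u : term) : Prop :=
  exists sigma, (forall i, FI P f i -> onth ts i = Some (sigma (X f i))) /\
                u = subst sigma (J f).

Definition int_orients (Z : int_theory) (P P' : set sdp)
    (X : fsym -> nat -> var) (J : fsym -> term) : Prop :=
  forall p, P p -> exists u v,
    [/\ int_value P X J (sdp_f p) (sdp_ss p) u,
        int_value P X J (sdp_g p) (sdp_ts p) v,
        P' p -> entails (sdp_phi p)
          (and_term Z (geq_term Z u (Fun (zero_sym Z))) (gt_term Z u v))
      & ~ P' p -> entails (sdp_phi p) (geq_term Z u v)].

Definition integer_mapping_processor (R : set rule) (Z : int_theory)
    (proc : processor) : Prop :=
  forall P Q, dp_problem R P -> proc P = Some Q ->
    exists P' X J,
      [/\ P' `<=` P, P' !=set0, formal_vars P X /\ integer_mapping Z P X J,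
          int_orients Z P P' X J & Q = [set P `\` P']].

Definition args_FV (I : set nat) (ts : seq term) : set var :=
  [set x | exists i u, [/\ I i, onth ts i = Some u & FV u x]].

Definition theory_argument_mapping (P : set sdp) (tau : fsym -> set nat)
    : Prop :=
  [/\ forall f, heads P f -> tau f `<=` theory_arg f,
      forall p i u, P p -> tau (sdp_f p) i -> onth (sdp_ss p) i = Some u ->
        theory_term u /\ FV u `<=` theory_sorted
    & forall p j u, P p -> tau (sdp_g p) j -> onth (sdp_ts p) j = Some u ->
        theory_term u /\
        FV u `<=` sdp_L p `|` args_FV (tau (sdp_f p)) (sdp_ss p)].

Definition extend_sdp (tau : fsym -> set nat) (p : sdp) : sdp :=
  Sdp (sdp_f p) (sdp_ss p) (sdp_g p) (sdp_ts p) (sdp_phi p)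
      (sdp_L p `|` args_FV (tau (sdp_f p)) (sdp_ss p)).

Definition fixes (tau : fsym -> set nat) (P' : set sdp) : Prop :=
  forall p, P' p -> args_FV (tau (sdp_g p)) (sdp_ts p) `<=` sdp_L p.

Definition theory_argument_processor (R : set rule) (proc : processor)
    : Prop :=
  forall P Q, dp_problem R P -> proc P = Some Q ->
    exists P' tau,
      [/\ P' `<=` P, P' !=set0, theory_argument_mapping P tau, fixes tau P'
        & Q = [set extend_sdp tau @` P; P `\` P']].

Definition crel : Type := term -> term -> term -> set var -> Prop.

Definition constrained_relation (R : set rule) (r : crel) : Prop :=
  forall s t phi L, r s t phi L ->
    [/\ exists A, has_xtype R s A /\ has_xtype R t A,
        logical_constraint phi, FV phi `<=` L & L `<=` theory_sorted].

Definition covers (r' : term -> term -> Prop) (r : crel) : Prop :=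
  forall s t phi L, r s t phi L ->
    forall sigma, substitution sigma -> respects sigma phi L ->
    forall s' t', calc_nf (subst sigma s) s' -> calc_nf (subst sigma t) t' ->
      r' s' t'.

Definition term_relation (R : set rule) (r : term -> term -> Prop) : Prop :=
  forall s t, r s t -> xterm R s /\ xterm R t.

Definition monotonic (R : set rule) (r : term -> term -> Prop) : Prop :=
  forall C s t, r s t -> xterm R (fill C s) -> xterm R (fill C t) ->
    r (fill C s) (fill C t).

Definition constrained_reduction_pair (R : set rule) (geq gt : crel) : Prop :=
  [/\ constrained_relation R geq, constrained_relation R gt
    & exists sqgeq sqgt : term -> term -> Prop,
      [/\ term_relation R sqgeq /\ term_relation R sqgt,
          covers sqgeq geq /\ covers sqgt gt,
          [/\ forall t, xterm R t -> sqgeq t t, monotonic R sqgeq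
            & forall s t, xterm R s -> calc s t -> sqgeq s t],
          well_founded (fun t s => sqgt s t)
        & forall s t u, sqgeq s t -> sqgt t u -> clos_trans term sqgt s u]].

Definition reduction_pair_processor (R : set rule) (proc : processor) : Prop :=
  forall P Q, dp_problem R P -> proc P = Some Q ->
    exists (P' : set sdp) (geq gt : crel),
      [/\ P' `<=` P /\ P' !=set0, constrained_reduction_pair R geq gt,
          forall p, P' p -> gt (sdp_lhs p) (sdp_rhs p) (sdp_phi p) (sdp_L p),
          (forall p, (P `\` P') p ->
             geq (sdp_lhs p) (sdp_rhs p) (sdp_phi p) (sdp_L p)) /\
          (forall rho, R rho ->
             geq (lhs rho) (rhs rho) (guard rho) (rule_lvars rho))
        & Q = [set P `\` P']].

End LCSTRS.

Arguments term : clear implicits.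
Arguments rule : clear implicits.
Arguments sdp : clear implicits.
Arguments processor : clear implicits.
Arguments int_theory : clear implicits.

(* Main.v *)
Require Import Defs.
From Stdlib Require List.
From Stdlib Require Import Relations.
From mathcomp Require Import all_boot all_order all_algebra.
From mathcomp Require Import boolp classical_sets cardinality.

Set Implicit Arguments.
Unset Strict Implicit.
Unset Printing Implicit Defensive.

Import Order.TTheory GRing.Theory Num.Theory.
Local Open Scope classical_set_scope.

(* In each case an infinite computable chain over P is turned into an infinite
   computable chain over one of the returned problems, or into an infinite
   descent.  If only finitely many steps of the chain use the removed set P', its
   tail lives in P \ P'; otherwise the strict steps recur.
   - Graph: some vertex is visited infinitely often, and from its first visit on
     the chain stays in the component of that vertex.
   - Subterm criterion: a marked term is only reduced below its root, so the
     projected arguments form an infinite sequence for the union of reduction and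
     the strict subterm relation, starting from a computable, hence terminating,
     term.
   - Integer mapping: the arguments used are ground theory terms after
     instantiation; reduction of such terms is calculation and preserves their
     interpretation, so the interpretations of J form a sequence of integers.
   - Theory arguments: once a step of P' is taken, the arguments selected by tau
     are ground theory terms, and this persists along the chain.
   - Reduction pair: reduction steps on terms become weak steps on their normal
     forms with respect to calculation. *)

(** * Descending sequences *)

Section Descent.
Context {T : Type}.
Implicit Types r ge gt : T -> T -> Prop.

Lemma terminating_clos_trans r t :
  Acc (fun v u => r u v) t -> Acc (fun v u => clos_trans T r u v) t.
Proof.
elim=> {}t _ IH; constructor=> u tu; elim: tu IH => {t u} [t u tu|t u v _ IHtu uv _] IH.
  exact: IH.
by case: (IHtu IH) => /(_ _ uv).
Qed.

Lemma terminating_steps r t u : Acc (fun v u => r u v) t ->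
  clos_refl_trans T r t u -> Acc (fun v u => r u v) u.
Proof.
move=> + tu; elim: tu => {t u} [t u tu|//|t u v _ IH1 _ IH2].
  by case=> /(_ _ tu).
by move=> /IH1 /IH2.
Qed.

Lemma clos_rt_mono (r q : T -> T -> Prop) x y : (forall a b, r a b -> q a b) ->
  clos_refl_trans T r x y -> clos_refl_trans T q x y.
Proof.
move=> rq; elim=> {x y} [x y xy|x|x y z _ xy _ yz].
- by apply: rt_step; exact: rq.
- exact: rt_refl.
- exact: rt_trans yz.
Qed.

(** Weak steps are absorbed by the strict step that follows them, so each recurring strict step
    yields a descent for the transitive closure of [gt]. Accessibility is demanded of [x 0] only,
    because for the subterm criterion nothing more than termination of the starting term is
    known. *)
Lemma no_infinite_descent ge gt (x : nat -> T) :
  (forall s t u, ge s t -> gt t u -> clos_trans T gt s u) ->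
  Acc (fun v u => gt u v) (x 0) ->
  (forall i, clos_refl_trans T ge (x i) (x i.+1) \/
     exists2 y, gt (x i) y & clos_refl_trans T ge y (x i.+1)) ->
  ~ (forall n, exists2 m, n <= m &
       exists2 y, gt (x m) y & clos_refl_trans T ge y (x m.+1)).
Proof.
move=> geC + xS inf => /terminating_clos_trans.
have geCt s t u : clos_refl_trans T ge s t -> clos_trans T gt t u ->
    clos_trans T gt s u.
  move=> st; elim: st u => {s t} [s t st|s|s t v _ IH1 _ IH2] u.
  - move=> tu; elim: tu st => {t u} [t u tu|t v u _ IH vu _] st.
      exact: geC tu.
    by apply: t_trans (IH st) vu.
  - by [].
  - by move/IH2/IH1.
(* The induction runs over a point [t] that weakly reaches the sequence, so that weak steps leave
   the induction subject unchanged. *)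
suff noge t : Acc (fun v u => clos_trans T gt u v) t ->
    forall n, ~ clos_refl_trans T ge t (x n).
  by move=> /noge /(_ 0); apply; exact: rt_refl.
elim=> {}t _ IH n tn.
have dec j z : clos_refl_trans T ge t (x j) -> gt (x j) z ->
    ~ clos_refl_trans T ge z (x j.+1).
  by move=> tj jz; apply: IH; apply: geCt tj (t_step _ _ _ _ jz).
have [m nm [y]] := inf n; rewrite -(subnKC nm) {nm}.
(* Induction on the distance to the next known strict step; a strict step met earlier is refuted by
   [dec] at once. *)
move: (m - n) => k; elim: k n tn => [|k IHk] n tn; first by rewrite addn0; exact: dec.
rewrite -addSnnS; have [xn|[z xz zx]] := xS n; last by case: (dec n z).
by apply: IHk; apply: rt_trans tn xn.
Qed.
End Descent.

(** * Terms, contexts and reduction *)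

Section Terms.
Context {sg : signature}.
Local Notation sort := (sort_of sg).
Local Notation carrier := (carrier (@dom sg)).
Implicit Types (s t u v l r : term sg) (ts us vs : seq (term sg)) (C D : @context sg).
Implicit Types (sigma tau : var sg -> term sg) (M : set (Defs.fsym sg)).
Implicit Types (R : set (rule sg)) (A B : ty sort).

Lemma apps_rcons t ts u : apps t (rcons ts u) = App (apps t ts) u.
Proof. by rewrite /apps foldl_rcons. Qed.

Fixpoint term_head t := if t is App s _ then term_head s else t.

Lemma head_apps t ts : term_head (apps t ts) = term_head t.
Proof. by elim/last_ind: ts => // ts u IH; rewrite apps_rcons. Qed.

Lemma apps_mark_inj f g ts us :
  apps (Mark f) ts = apps (Mark g) us -> f = g /\ ts = us.
Proof.
move=> E; have := congr1 term_head E; rewrite !head_apps => -[fg]; split=> //.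
rewrite -fg in E; elim/last_ind: ts us E => [|ts t IH] us.
  by case/lastP: us => // us u; rewrite apps_rcons.
case/lastP: us => [|us u]; rewrite !apps_rcons // => -[/IH -> ->] //.
Qed.

Lemma subst_apps sigma t ts :
  subst sigma (apps t ts) = apps (subst sigma t) (map (subst sigma) ts).
Proof.
by elim/last_ind: ts => // ts u IH; rewrite map_rcons !apps_rcons /= IH.
Qed.

Lemma subst_comp sigma tau t :
  subst sigma (subst tau t) = subst (subst sigma \o tau) t.
Proof. by elim: t => //= s -> u ->. Qed.

Fixpoint ccomp C D : @context sg :=
  match C with
  | Hole => D
  | CAppl E u => CAppl (ccomp E D) u
  | CAppr u E => CAppr u (ccomp E D)
  end.

Lemma fill_ccomp C D t : fill (ccomp C D) t = fill C (fill D t).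
Proof. by elim: C => //= [E -> u|u E ->]. Qed.

Fixpoint csubst sigma C : @context sg :=
  match C with
  | Hole => @Hole sg
  | CAppl E u => CAppl (csubst sigma E) (subst sigma u)
  | CAppr u E => CAppr (subst sigma u) (csubst sigma E)
  end.

Lemma subst_fill sigma C t :
  subst sigma (fill C t) = fill (csubst sigma C) (subst sigma t).
Proof. by elim: C => //= [E -> u|u E ->]. Qed.

Fixpoint tsize t := if t is App s u then (tsize s + tsize u).+1 else 1.

(** The inequality excludes cyclic subterm relations; its equality case makes the passage to a
    proper subterm decrease the size. *)
Lemma tsize_fill C t : tsize t <= tsize (fill C t) ?= iff `[< C = @Hole sg >].
Proof.
elim: C => [|E IH u|u E IH] /=; apply/leqifP.
- by rewrite asboolT.
- rewrite asboolF //; rewrite ltnS; apply: leq_trans (leq_addr _ _); exact: IH.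
- rewrite asboolF //; rewrite ltnS; apply: leq_trans (leq_addl _ _); exact: IH.
Qed.

Lemma subterm_fill s t : subterm s t -> exists C, s = fill C t.
Proof.
elim=> {s t} [s|s u t _ [C ->]|s u t _ [C ->] _].
- by exists (@Hole sg).
- by exists (CAppr s C).
- by exists (CAppl C u).
Qed.

Lemma strict_subterm_fill s t :
  strict_subterm s t -> exists2 C, C <> @Hole sg & s = fill C t.
Proof.
move=> [/subterm_fill[C ->]] nst; exists C => // C0.
by apply: nst; rewrite C0; exact: subterm_refl.
Qed.

Lemma tsize_arg t ts i u : onth ts i = Some u -> tsize u < tsize (apps t ts).
Proof.
elim/last_ind: ts => [|ts v IH]; first by rewrite onth0n.
rewrite apps_rcons -cats1 onth_cat /=; case: ifP => [_ /IH lt|_].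
  by apply: leqW; apply: leq_trans lt (leq_addr _ _).
by case/onth1P=> _ ->; rewrite ltnS leq_addl.
Qed.

(** Sizes rule out both the converse subterm relation and the equality that [subterm_l] forbids. On
    chains this makes the arguments of right-hand sides computable. *)
Lemma strict_subterm_apps t ts i u :
  onth ts i = Some u -> strict_subterm (apps t ts) u.
Proof.
move=> Hi; split; last first.
  move=> /subterm_fill[C E]; have := tsize_arg t Hi.
  by rewrite E ltnNge (tsize_fill C (apps t ts)).
elim/last_ind: ts Hi => [|ts v IH]; first by rewrite onth0n.
rewrite apps_rcons -cats1 onth_cat; case: ifP => [_ Hi|_]; last first.
  by case/onth1P=> _ ->; apply: subterm_r; exact: subterm_refl.
apply: subterm_l; first exact: IH.
by move=> E; have := tsize_arg t Hi; rewrite E ltnn.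
Qed.

(** * Reduction inside contexts and below marked symbols *)

Lemma fill_calc C s t : calc s t -> calc (fill C s) (fill C t).
Proof.
case=> D f vs v A a th ne val valv d1 d2; rewrite -!fill_ccomp.
exact: calc_step d1 d2.
Qed.

Lemma fill_step R C s t : step R s t -> step R (fill C s) (fill C t).
Proof.
case=> [D rho sigma Rr sub resp|{}s {}t st].
  by rewrite -!fill_ccomp; exact: step_rule.
by apply: step_calc; exact: fill_calc.
Qed.

(** Redexes are separated from their context so that the context can be analysed by induction. *)
Variant calc_root : term sg -> term sg -> Prop :=
| CalcRoot f vs v A (a : carrier A) :
    thsym f -> vs <> [::] -> List.Forall value vs -> value v ->
    denote (apps (Fun f) vs) a -> denote v a ->
    calc_root (apps (Fun f) vs) v.

Lemma calcP s t : calc s t <->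
  exists C l r, [/\ calc_root l r, s = fill C l & t = fill C r].
Proof.
split=> [[C f vs v A a th ne val valv d1 d2]|[C [l [r [lr -> ->]]]]]; last first.
  by case: lr => f vs v A a th ne val valv d1 d2; exact: calc_step d1 d2.
by exists C, (apps (Fun f) vs), v; split=> //; exact: CalcRoot d1 d2.
Qed.

Variant step_root R : term sg -> term sg -> Prop :=
| RuleRoot rho sigma : R rho -> substitution sigma -> respects_rule sigma rho ->
    step_root R (subst sigma (lhs rho)) (subst sigma (rhs rho))
| CalcStepRoot l r : calc_root l r -> step_root R l r.

Lemma step_root_fill R s t : step R s t ->
  exists C l r, [/\ step_root R l r, s = fill C l & t = fill C r].
Proof.
case=> [C rho sigma Rr sub resp|{}s {}t /calcP[C [l [r [lr -> ->]]]]].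
  by do 3!eexists; split=> //; exact: RuleRoot.
by do 3!eexists; split=> //; exact: CalcStepRoot.
Qed.

Lemma step_root_head R l r : lcstrs R -> step_root R l r -> exists f, term_head l = Fun f.
Proof.
move=> lc [rho sigma /lc[_ _ _ [_ [f [ts ->]]] _] _ _|_ _ [f vs *]]; exists f.
  by rewrite subst_apps head_apps.
by rewrite head_apps.
Qed.

(** Every redex, for rules and for calculation alike, is headed by a function symbol. A term headed
    by a variable or a marked symbol is therefore never contracted at its root. *)
Lemma step_unheaded R s t : lcstrs R -> (forall f, term_head s <> Fun f) ->
  step R s t -> exists s0 s1,
    s = App s0 s1 /\ ((exists2 s0', step R s0 s0' & t = App s0' s1) \/
                      (exists2 s1', step R s1 s1' & t = App s0 s1')).
Proof.
move=> lc hs /step_root_fill[C [l [r [lr Es ->]]]].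
have step_fill D : step R (fill D l) (fill D r).
  clear Es.
  case: lr => [rho sigma *|l0 r0 lr]; first exact: step_rule.
  by apply/step_calc/calcP; exists D, l0, r0.
case: C Es => [|D u|u D] /= Es.
- by have [f] := step_root_head lc lr; rewrite -Es => /hs.
- by exists (fill D l), u; split=> //; left; exists (fill D r).
- by exists u, (fill D l); split=> //; right; exists (fill D r).
Qed.

(** With [nth] no case of a missing argument arises: beyond the common length both sides are the
    default [d], and reflexivity applies. *)
Lemma step_apps_mark R f ts t : lcstrs R -> step R (apps (Mark f) ts) t ->
  exists2 us, t = apps (Mark f) us &
    size us = size ts /\ forall d i, steps R (nth d ts i) (nth d us i).
Proof.
move=> lc; elim/last_ind: ts t => [|ts v IH] t st.
  by have [//|? [? []]] := step_unheaded lc _ st.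
have hd g : term_head (apps (Mark f) (rcons ts v)) <> Fun g by rewrite head_apps.
have [s0 [s1 [E]]] := step_unheaded lc hd st; rewrite apps_rcons in E.
case: E => <- <- {s0 s1} [[s0 /IH[us -> [sz nths]] ->]|[v' st' ->]].
  exists (rcons us v); first by rewrite apps_rcons.
  split=> [|d i]; first by rewrite !size_rcons sz.
  rewrite !nth_rcons sz; case: ifP => // _; exact: rt_refl.
exists (rcons ts v'); first by rewrite apps_rcons.
split=> [|d i]; first by rewrite !size_rcons.
rewrite !nth_rcons; case: ifP => _; first exact: rt_refl.
case: ifP => _; last exact: rt_refl.
exact: rt_step.
Qed.

Lemma steps_apps_mark R f ts t : lcstrs R -> steps R (apps (Mark f) ts) t ->
  exists2 us, t = apps (Mark f) us &
    size us = size ts /\ forall d i, steps R (nth d ts i) (nth d us i).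
Proof.
move=> lc /clos_rt_rtn1_iff; elim=> [|v v' vv' _ [us Et [sz nths]]].
  by exists ts => //; split=> // d i; exact: rt_refl.
subst v; have [us' -> [sz' nths']] := step_apps_mark lc vv'.
exists us' => //; split=> [|d i]; first by rewrite sz'.
exact: rt_trans (nths d i) (nths' d i).
Qed.

Lemma steps_marked R f g ts us : lcstrs R ->
  steps R (apps (Mark f) ts) (apps (Mark g) us) ->
  f = g /\ forall i u, onth us i = Some u ->
    exists2 t, onth ts i = Some t & steps R t u.
Proof.
move=> lc /(steps_apps_mark lc)[us' /apps_mark_inj[-> ->] [sz nths]].
split=> // i u usi.
have : i < size us' by rewrite -onthTE usi.
rewrite sz -onthTE; case E: (onth ts i) => [t|] // _; exists t => //.
by have := nths t i; rewrite (@onth_nth _ t _ _ _ E) (@onth_nth _ t _ _ _ usi).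
Qed.

(** The strict subterm relation is represented by contexts other than the hole, which are easily
    composed and instantiated. *)
Definition step_or_subterm R u v : Prop :=
  step R u v \/ exists2 C, C <> @Hole sg & u = fill C v.

(** Lexicographic induction on the reductions of the surrounding term [t] and on the size of its
    subterm [u]: a step in [u] is a step in [t], and a proper subterm of [u] is a smaller subterm of
    the same [t]. *)
Lemma terminating_step_or_subterm R t :
  terminating (step R) t -> terminating (step_or_subterm R) t.
Proof.
move=> tt; suff sub C u : t = fill C u -> terminating (step_or_subterm R) u.
  exact: (sub (@Hole sg) t erefl).
elim: tt C u => {}t _ IH C u.
have [n] := ubnP (tsize u); elim: n C u => [C u|n IHn C u un Et].
  by move=> {IH}; rewrite ltn0.
constructor=> v [uv|[D D0 Eu]].
  apply: (IH (fill C v) _ C v erefl); rewrite Et; exact: fill_step.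
apply: (IHn (ccomp C D)); last by rewrite fill_ccomp -Eu.
rewrite ltnS in un; apply: leq_trans un; rewrite Eu.
have lt := tsize_fill D v; rewrite ltn_neqAle lt.2 lt.1 andbT.
exact/asboolPn.
Qed.
End Terms.

(** * Typing and interpretation *)

Section Interpretation.
Context {sg : signature}.
Local Notation sort := (sort_of sg).
Local Notation carrier := (carrier (@dom sg)).
Local Notation lift := (@Defs.lift sg).
Implicit Types (s t u v l r : term sg) (ts us vs : seq (term sg)) (C D : @context sg).
Implicit Types (sigma tau : var sg -> term sg) (M : set (Defs.fsym sg)).
Implicit Types (R : set (rule sg)) (A B : ty sort).

Lemma lift_inj : injective (lift).
Proof.
by elim=> [a|A IHA B IHB] [b|A' B'] //= [] => [->|/IHA -> /IHB ->].
Qed.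

Lemma typedP M t T : typed M t T ->
  match t with
  | Fun f => T = lift (ftype f)
  | Mark f => M f /\ T = sharp (ftype f)
  | Var x => T = lift (vtype x)
  | App s u => exists2 U, typed M s (Arr U T) & typed M u U
  end.
Proof. by case=> // s u U V sU uU; exists U. Qed.

Lemma typed_unique M t T U : typed M t T -> typed M t U -> T = U.
Proof.
elim: t T U => [f|f|x|s IHs u IHu] T U /typedP Ht /typedP Hu.
- by rewrite Ht Hu.
- by rewrite Ht.2 Hu.2.
- by rewrite Ht Hu.
- by case: Ht Hu => [T' sT _] [U' sU _]; case: (IHs _ _ sT sU).
Qed.

Lemma typed_sub M N t T : M `<=` N -> typed M t T -> typed N t T.
Proof.
move=> MN; elim=> {t T} [f|f Mf|x|s t T U _ sT _ tU].
- exact: typed_fun.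
- by apply: typed_mark; exact: MN.
- exact: typed_var.
- exact: typed_app tU.
Qed.

Lemma typed_subst M sigma t T :
  substitution sigma -> typed M t T -> typed M (subst sigma t) T.
Proof.
move=> sub; elim=> {t T} [f|f Mf|x|s t T U _ sT _ tU] /=.
- exact: typed_fun.
- exact: typed_mark.
- by apply: typed_sub (sub x) => ? [].
- exact: typed_app tU.
Qed.

Lemma typed_fill M C s T : typed M (fill C s) T ->
  exists2 U, typed M s U & forall t, typed M t U -> typed M (fill C t) T.
Proof.
elim: C T => [|D IH u|u D IH] T /= sT; first by exists T.
  have [U /IH[V sV HV] uU] := typedP sT.
  by exists V => // t /HV tU; exact: typed_app uU.
have [U uU /IH[V sV HV]] := typedP sT.
by exists V => // t /HV tU; exact: typed_app tU.
Qed.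

(** Only marked symbols can introduce [dp] into a type. *)
Lemma typed0_lift t T : typed set0 t T -> exists A, T = lift A.
Proof.
elim=> {t T} [f|f []|x|s t T U _ [[//|A B] [_ ->]] _ _]; last by exists B.
- by exists (ftype f).
- by exists (vtype x).
Qed.

(** Proof irrelevance identifies the extracted equality of types with reflexivity, which removes the
    transport. *)
Lemma existT_inj A (a b : carrier A) :
  existT carrier A a = existT carrier A b -> a = b.
Proof.
by move=> E; have := projT2_eq E; rewrite (Prop_irrelevance (projT1_eq E) erefl).
Qed.

Lemma interp_as_type f A (a : carrier A) : interp_as f a -> ftype f = A.
Proof. by move=> [h /(congr1 (@projT1 _ _))]. Qed.

Lemma interp_as_unique f A (a : carrier A) B (b : carrier B) :
  interp_as f a -> interp_as f b -> existT carrier A a = existT carrier B b.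
Proof.
by move=> [h <-] [h' <-]; rewrite (Prop_irrelevance h h').
Qed.

Lemma denoteP t A (a : carrier A) : denote t a ->
  match t with
  | Fun f => interp_as f a
  | App s u => exists B (g : carrier (Arr B A)) (b : carrier B),
      [/\ denote s g, denote u b & a = g b]
  | _ => False
  end.
Proof. by case=> // s u B B' g b sg' ub; exists B, g, b. Qed.

(** The two types are not assumed equal: the argument type of an application is hidden, and only the
    interpretations of the function part show that both choices agree. Hence the equality of
    dependent pairs. *)
Lemma denote_unique t A (a : carrier A) B (b : carrier B) :
  denote t a -> denote t b -> existT carrier A a = existT carrier B b.
Proof.
elim: t A a B b => [f|f|x|s IHs u IHu] A a B b /denoteP Ha /denoteP Hb //.
  exact: interp_as_unique Hb.
case: Ha Hb => A' [g [a' [sg' ua ->]]] [B' [h [b' [sh ub ->]]]].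
have E := IHs _ _ _ _ sg' sh.
have [E1 E2] := congr1 (@projT1 _ _) E; subst A' B.
by rewrite (existT_inj E) (existT_inj (IHu _ _ _ _ ua ub)).
Qed.

Lemma denote_typed M t A (a : carrier A) : denote t a -> typed M t (lift A).
Proof.
elim=> {t A a} [f A a fa|s t A B g a _ sA _ tA].
  by rewrite -(interp_as_type fa); exact: typed_fun.
exact: typed_app sA tA.
Qed.

Lemma denote_total t A :
  ground_theory_term t -> has_type t A -> exists a : carrier A, denote t a.
Proof.
rewrite /has_type => -[].
elim: t A => [f|f|x|s IHs u IHu] A //=.
- move=> thf _ /typedP /lift_inj ->; exists (interp thf).
  by apply: denote_fun; exists thf.
- by move=> _ E; have: [set x] x by []; rewrite E.
- move=> [ths thu]; rewrite setU_eq0 => -[FVs FVu].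
  move=> /typedP[U sU uU]; have [B EB] := typed0_lift uU; subst U.
  have [b ub] := IHu B thu FVu uU; have [g sg'] := IHs (Arr B A) ths FVs sU.
  by exists (g b); exact: denote_app.
Qed.

(** This is the surjective half of [interp_bij]. *)
Lemma value_total (S : sort) (a : dom S) : thsort S ->
  exists2 v, value v & denote v (a : carrier (Base S)).
Proof.
move=> /interp_bij/(_ a)[f [[h E] _]]; exists (Fun f); last first.
  by apply: denote_fun; exists h.
by exists f, S; split=> //; exact: (congr1 (@projT1 _ _) E).
Qed.

Lemma value_denote v : value v ->
  exists2 S : sort, thsort S & exists a : dom S, denote v (a : carrier (Base S)).
Proof.
move=> [f [S [-> thf fS]]]; exists S.
  by have := thsym_type thf; rewrite fS.
have := @denote_total (Fun f) (Base S); apply=> //.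
by rewrite /has_type -fS; exact: typed_fun.
Qed.

(** This is the injective half of [interp_bij], once [A] is recognised as a theory sort. *)
Lemma value_unique v w A (a : carrier A) :
  value v -> value w -> denote v a -> denote w a -> v = w.
Proof.
move=> vv vw va wa; have [S thS [b vb]] := value_denote vv.
have E := denote_unique vb va.
have E1 := congr1 (@projT1 _ _) E; rewrite /= in E1; subst A.
have {}E := existT_inj E; subst b.
case: vv vw va wa => f [_ [-> _ _]] [g [_ [-> _ _]]] /denoteP fa /denoteP ga.
have [h [_ uniq]] := interp_bij thS a.
by rewrite -(uniq f fa) -(uniq g ga).
Qed.

Lemma value_ground v : value v -> ground_theory_term v.
Proof. by move=> [f [S [-> thf _]]]. Qed.

Lemma denote_subst sigma tau t :
  (forall x, FV t x -> forall A (a : carrier A),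
     denote (sigma x) a -> denote (tau x) a) ->
  forall A (a : carrier A), denote (subst sigma t) a -> denote (subst tau t) a.
Proof.
elim: t => [f|f|x|s IHs u IHu] //= H A a; first exact: H.
move=> /denoteP[B [g [b [sg' ub ->]]]]; apply: denote_app.
  by apply: IHs sg' => x xs; apply: H; left.
by apply: IHu ub => x xu; apply: H; right.
Qed.

Lemma denote_fill C s t :
  (forall A (a : carrier A), denote s a -> denote t a) ->
  forall A (a : carrier A), denote (fill C s) a -> denote (fill C t) a.
Proof.
move=> st; elim: C => [|D IH u|u D IH] A a //=; first exact: st.
  by move=> /denoteP[B [g [b [/IH sg' ub ->]]]]; exact: denote_app.
by move=> /denoteP[B [g [b [sg' /IH ub ->]]]]; exact: denote_app.
Qed.

(** * Ground theory terms and their reduction *)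

Lemma theory_term_fill C s : theory_term (fill C s) -> theory_term s.
Proof. by elim: C => //= [D IH u|u D IH] [] // /IH. Qed.

Lemma ground_theory_app s u : ground_theory_term (App s u) <->
  ground_theory_term s /\ ground_theory_term u.
Proof.
have FVE : FV (App s u) = FV s `|` FV u by [].
rewrite /ground_theory_term FVE setU_eq0 /=; tauto.
Qed.

Lemma ground_theory_fill C s t : ground_theory_term (fill C s) ->
  ground_theory_term t -> ground_theory_term (fill C t).
Proof.
move=> + Gt; elim: C => [|D IH u|u D IH] //=.
  by move=> /ground_theory_app[/IH Gs Gu]; apply/ground_theory_app.
by move=> /ground_theory_app[Gu /IH Gs]; apply/ground_theory_app.
Qed.

Lemma ground_theory_subst sigma t :
  theory_term t -> (forall x, FV t x -> ground_theory_term (sigma x)) ->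
  ground_theory_term (subst sigma t).
Proof.
elim: t => [f|f|x|s IHs u IHu] //=; first by move=> _; apply.
move=> [ths thu] H; apply/ground_theory_app; split.
  by apply: IHs => // x xs; apply: H; left.
by apply: IHu => // x xs; apply: H; right.
Qed.

Lemma ground_theory_subst_var sigma t x :
  ground_theory_term (subst sigma t) -> FV t x -> ground_theory_term (sigma x).
Proof.
elim: t => [f|f|y|s IHs u IHu] //=; first by move=> + ->.
by move=> /ground_theory_app[Gs Gu] [/(IHs Gs)|/(IHu Gu)].
Qed.

(** The symbol outside the theory that a left-hand side contains survives instantiation. *)
Lemma lhs_not_theory rho sigma :
  is_rule rho -> ~ theory_term (subst sigma (lhs rho)).
Proof.
move=> [_ _ _ _ [C [f [-> nth]]]]; rewrite subst_fill => /theory_term_fill.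
exact/negP.
Qed.

(** No rule applies inside a theory term by [lhs_not_theory], and a calculation step replaces a
    subterm by a value with the same interpretation. *)
Lemma steps_ground_theory R s t : lcstrs R -> steps R s t ->
  ground_theory_term s ->
  ground_theory_term t /\
  forall A (a : carrier A), denote s a -> denote t a.
Proof.
move=> lc; elim=> {s t} [s t st|s|s t u _ IH1 _ IH2] // Gs; last first.
  have [Gt st] := IH1 Gs; have [Gu tu] := IH2 Gt.
  by split=> // A a /st /tu.
case: st Gs => [C rho sigma /lc Rr _ _ [/theory_term_fill + _]|_ _ []].
  by move=> /(lhs_not_theory Rr).
move=> C f vs v A a thf vs0 _ vv sa va Gs; split.
  by apply: ground_theory_fill Gs _; exact: value_ground.
apply: denote_fill => B b sb; have E := denote_unique sa sb.
have E1 := congr1 (@projT1 _ _) E; rewrite /= in E1; subst B.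
by rewrite -(existT_inj E).
Qed.

(** * Preservation of types under reduction *)

Lemma calc_typed M s t T : calc s t -> typed M s T -> typed M t T.
Proof.
case=> C f vs v A a _ _ _ _ sa va /typed_fill[U sU]; apply.
by rewrite (typed_unique sU (denote_typed M sa)); exact: denote_typed va.
Qed.

Lemma rule_inst_typed M rho sigma : is_rule rho -> substitution sigma ->
  exists2 T, typed M (subst sigma (lhs rho)) T &
             typed M (subst sigma (rhs rho)) T.
Proof.
move=> [[A [lA rA]] _ _ _ _] sub; exists (lift A); apply: typed_subst => //.
  by apply: typed_sub lA => ? [].
by apply: typed_sub rA => ? [].
Qed.

Lemma step_typed R M s t T :
  lcstrs R -> step R s t -> typed M s T -> typed M t T.
Proof.
move=> lc [C rho sigma /lc Rr sub _|{}s {}t]; last exact: calc_typed.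
move=> /typed_fill[U lU]; apply.
have [T' lT rT] := rule_inst_typed M Rr sub.
by rewrite (typed_unique lU lT).
Qed.

End Interpretation.

(** * Chains *)

Section Chains.
Context {sg : signature} (R : set (rule sg)) (lcR : lcstrs R).
Context (I : sort_of sg -> set (term sg)).
Local Notation carrier := (carrier (@dom sg)).
Local Notation lift := (@Defs.lift sg).
Implicit Types (P : set (sdp sg)) (c : nat -> sdp sg * (var sg -> term sg)).
Implicit Types (s t u v : term sg) (sigma tau : var sg -> term sg).

Lemma chain_tail P P' c n : computable_chain R I P None c ->
  (forall i, n <= i -> P' (c i).1) ->
  computable_chain R I P' None (fun i => c (n + i)).
Proof.
move=> [[c1 c2] c3] P'c; split; last by move=> i u _; exact: c3.
split=> i _; last by rewrite addnS; exact: c2.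
by have [_ ? ?] := c1 (n + i) isT; split=> //; apply: P'c; exact: leq_addr.
Qed.

Lemma infinitely_often P P' c : dp_finite R I (P `\` P') ->
  computable_chain R I P None c ->
  forall n, exists2 m, n <= m & P' (c m).1.
Proof.
move=> fin cc n; apply: contrapT => no; apply: fin.
exists (fun i => c (n + i)); apply: (chain_tail cc) => i ni.
have [Pc _ _] := cc.1.1 i isT; split=> // P'c; apply: no.
by exists i.
Qed.

(** No step happens at a marked head, so the reduction joining two consecutive pairs splits into
    reductions of the separate arguments. *)
Lemma chain_link P c i : chain R P None c ->
  sdp_g (c i).1 = sdp_f (c i.+1).1 /\
  forall j s, onth (sdp_ss (c i.+1).1) j = Some s ->
    exists2 t, onth (sdp_ts (c i).1) j = Some t &
      steps R (subst (c i).2 t) (subst (c i.+1).2 s).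
Proof.
move=> [_ /(_ i isT)]; rewrite /sdp_rhs /sdp_lhs !subst_apps /=.
move=> /(steps_marked lcR)[fg args]; split=> // j s sj.
have := args j (subst (c i.+1).2 s); rewrite !onth_map sj => /(_ erefl)[t'].
by case: onth => // t [<-] ts; exists t.
Qed.

Lemma graph_sound proc : graph_processor R proc -> sound R I proc.
Proof.
move=> procP P Q /procP H /H[V [edge [theta [approx ->]]]] fin [c cc].
pose x i := theta (c i).1.
have xedge i : edge (x i) (x i.+1).
  apply: (approx _ _ (c i).2 (c i.+1).2); split=> [[|[|//]] _|[|//] _] /=.
  - exact: cc.1.1.
  - exact: cc.1.1.
  - exact: cc.1.2.
have xconn i j : i <= j -> connect edge (x i) (x j).
  move=> /subnKC <-; elim: (j - i) => [|k IH]; first by rewrite addn0.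
  by rewrite addnS; apply: connect_trans IH (connect1 _).
(* Pigeonhole principle: if each vertex [v] were visited only before some index [N v], the vertex at
   the maximum of these indices would contradict its own bound. *)
have [v vinf] : exists v : V, forall n, exists2 m, n <= m & x m = v.
  apply: contrapT => no.
  have /choice[N HN] (v : V) : exists n, forall m, n <= m -> x m <> v.
    apply: contrapT => nN; apply: no; exists v => n; apply: contrapT => nm.
    by apply: nN; exists n => m lenm xm; apply: nm; exists m.
  pose n := \max_v N v; apply: (HN (x n) n) => //; exact: leq_bigmax.
have [n _ xn] := vinf 0.
pose S := [set w | connect edge v w && connect edge w v]%SET.
have xS i : n <= i -> x i \in S.
  (* The vertex [v] reaches [x i] because it is [x n], and [x i] reaches [v] because [v] is visited
     again later. *)
  move=> ni; rewrite inE -{1}xn xconn //=.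
  by have [m im <-] := vinf i; exact: xconn.
apply: (fin [set p | P p /\ theta p \in S]).
  exists S; split=> //; first by exists v.
  by exists (x n), (x n.+1); split; [exact: xS | exact: xS | exact: xedge].
exists (fun i => c (n + i)); apply: (chain_tail cc) => i ni.
by have [Pc _ _] := cc.1.1 i isT; split=> //; exact: xS.
Qed.

(** The three properties need a joint induction on the type: termination at an arrow type applies
    the term to a variable, computable by the third property of the argument type, while the third
    property at an arrow type uses termination of the argument. *)
Lemma computable_atP A : rc_set R I ->
  [/\ forall t, computable_at I A t -> has_type t A /\ terminating (step R) t,
      forall t t', computable_at I A t -> step R t t' -> computable_at I A t'
    & forall x ts, has_type (apps (Var x) ts) A ->
        (forall t', step R (apps (Var x) ts) t' -> computable_at I A t') ->
        computable_at I A (apps (Var x) ts)].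
Proof.
move=> [rc1 rc2 rc3]; elim: A => [S|A [A1 A2 A3] B [B1 B2 B3]] /=.
  by split=> [t|t t'|x ts]; [exact: rc1 | exact: rc2 | exact: rc3].
split.
- move=> t [tAB tc]; split; first exact: tAB.
  have [x xA] : [set x | @vtype sg x = A] !=set0.
    by apply/set0P/negP => /eqP E; apply: (@var_infinite sg A); rewrite E.
  have xc : computable_at I A (Var x).
    apply: (A3 x [::]) => [|t']; first by rewrite -xA; exact: typed_var.
    by move=> /(step_unheaded lcR)[//|? [? []]].
  have [_] := B1 _ (tc _ xc).
  (* A reduction of [t] is also one of [t] applied to the variable, so termination passes from the
     application to [t]. *)
  move E: (App t _) => s; move=> st; elim: st t E {tAB tc} => {}s _ IH t Es.
  constructor=> u tu; apply: (IH (App u (Var x)) _ u erefl); rewrite -Es.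
  exact: (fill_step (CAppl (@Hole sg) (Var x)) tu).
- move=> t t' [tAB tc] tt'; split; first exact: step_typed tt' tAB.
  move=> u uc; apply: B2 (tc u uc) _.
  exact: (fill_step (CAppl (@Hole sg) u) tt').
- move=> x ts tAB red; split=> // u uc; have [_ ut] := A1 u uc.
  (* Induction on the reductions of the argument: a reduct of the neutral application changes either
     its function part, handled by [red], or [u], handled by [IH]. *)
  elim: ut uc => {}u _ IH uc; rewrite -apps_rcons; apply: B3.
    rewrite apps_rcons; apply: typed_app tAB _; exact: (A1 u uc).1.
  rewrite apps_rcons => t' /(step_unheaded lcR) [|s0 [s1 [[<- <-]]]].
    by move=> f /=; rewrite head_apps.
  case=> [[s' /red[_ sc] ->]|[u' uu' ->]]; first exact: sc.
  by apply: IH => //; exact: A2 uu'.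
Qed.

Lemma subst_step_or_subterm sigma u v : strict_subterm u v ->
  step_or_subterm R (subst sigma u) (subst sigma v).
Proof.
move=> /strict_subterm_fill[C C0 ->]; right; exists (csubst sigma C).
  by case: C C0.
by rewrite subst_fill.
Qed.

Lemma subterm_criterion_sound proc : rc_set R I ->
  subterm_criterion_processor R proc -> sound R I proc.
Proof.
move=> rcI procP P Q /procP H /H[P' [nu [subP _ _ [strict eqv] ->]]] fin [c cc].
have inf := infinitely_often (fin _ erefl) cc.
have /choice[y yP] i : exists y : term sg * term sg,
    [/\ onth (sdp_ss (c i).1) (nu (sdp_f (c i).1)) = Some y.1,
        onth (sdp_ts (c i).1) (nu (sdp_g (c i).1)) = Some y.2,
        P' (c i).1 -> strict_subterm y.1 y.2 & ~ P' (c i).1 -> y.1 = y.2].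
  have [Pc _ _] := cc.1.1 i isT; have [P'c|nP'c] := pselect (P' (c i).1).
    by have [u [v [uE vE uv]]] := strict _ P'c; exists (u, v).
  by have [|u [uE vE]] := eqv (c i).1 _; [split | exists (u, u)].
have yS i : steps R (subst (c i).2 (y i).2) (subst (c i.+1).2 (y i.+1).1).
  have [fg args] := chain_link i cc.1.
  have [yS _ _ _] := yP i.+1; have [t] := args _ _ yS.
  by have [_ yi _ _] := yP i; rewrite -fg yi => -[->].
(* The sequence starts at index 1: computability is known for arguments of right-hand sides only,
   and [x 0] is a reduct of the projected argument of the right-hand side at index 0. *)
pose x i := subst (c i.+1).2 (y i.+1).1.
have yS' i : clos_refl_trans _ (step_or_subterm R)
    (subst (c i.+1).2 (y i.+1).2) (x i.+1).
  by apply: clos_rt_mono (yS i.+1) => s t; left.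
apply: (@no_infinite_descent _ (step_or_subterm R) (step_or_subterm R) x).
(* The same relation serves as weak and as strict one; equality of projected arguments needs no step
   of its own. *)
- by move=> s t u st tu; apply: t_trans; apply: t_step; [exact: st | exact: tu].
- apply: terminating_step_or_subterm.
  have [A tA] : computable I (subst (c 0).2 (y 0).2).
    apply: cc.2 => //; have [_ y0 _ _] := yP 0; exact: strict_subterm_apps y0.
  have [red _ _] := computable_atP A rcI; have [_ ter] := red _ tA.
  exact: terminating_steps ter (yS 0).
- move=> i; have [_ _ gt eq] := yP i.+1.
  have [/gt uv|/eq uv] := pselect (P' (c i.+1).1); [right | left].
    by exists (subst (c i.+1).2 (y i.+1).2); [exact: subst_step_or_subterm | exact: yS'].
  by rewrite /x uv; exact: yS'.
- move=> n; have [[//|m] nm P'm] := inf n.+1; exists m => //.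
  exists (subst (c m.+1).2 (y m.+1).2); last exact: yS'.
  by apply: subst_step_or_subterm; have [_ _ gt _] := yP m.+1; exact: gt.
Qed.
End Chains.

(** * Theory arguments and integer mappings *)

Section TheoryProcessors.
Context {sg : signature} (R : set (rule sg)) (lcR : lcstrs R).
Context (I : sort_of sg -> set (term sg)).
Local Notation carrier := (carrier (@dom sg)).
Implicit Types (P : set (sdp sg)) (c : nat -> sdp sg * (var sg -> term sg)).
Implicit Types (s t u v : term sg) (sigma tau : var sg -> term sg).

Lemma theory_argument_sound proc :
  theory_argument_processor R proc -> sound R I proc.
Proof.
move=> procP P Q /procP H /H[P' [tau [subP _ [_ tauS tauT] fixP ->]]] fin [c cc].
have [n _ P'n] := infinitely_often (fin _ (or_intror erefl)) cc 0.
have Pc i : P (c i).1 by have [] := cc.1.1 i isT.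
have GL i x : sdp_L (c i).1 x -> ground_theory_term ((c i).2 x).
  by have [_ _ [+ _]] := cc.1.1 i isT; apply.
(* This invariant on right-hand sides passes through the linking reduction to the next left-hand
   side ([groundS]), starts at a fixed pair ([GTn]) and persists by the conditions on [tau]
   ([GTS]). *)
pose groundT i := forall j t, tau (sdp_g (c i).1) j ->
  onth (sdp_ts (c i).1) j = Some t -> ground_theory_term (subst (c i).2 t).
have groundS i : groundT i -> forall x,
    args_FV (tau (sdp_f (c i.+1).1)) (sdp_ss (c i.+1).1) x ->
    ground_theory_term ((c i.+1).2 x).
  move=> GT x [j [s [tauj sj sx]]]; have [fg args] := chain_link lcR i cc.1.
  have [t tj ts] := args j s sj.
  have [|Gs _] := steps_ground_theory lcR ts; first by apply: GT tj; rewrite fg.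
  exact: ground_theory_subst_var Gs sx.
have GTn : groundT n.
  move=> j t tauj tj; apply: ground_theory_subst.
    by have [] := tauT _ _ _ (Pc n) tauj tj.
  by move=> x xt; apply: GL; apply: (fixP _ P'n); exists j, t.
have GTS i : groundT i -> groundT i.+1.
  move=> GT j t tauj tj; have [tht FVt] := tauT _ _ _ (Pc i.+1) tauj tj.
  by apply: ground_theory_subst => // x /FVt[/GL|/(groundS i GT)].
have GT i : groundT (n + i).
  by elim: i => [|i]; rewrite ?addn0 // addnS; exact: GTS.
apply: (fin _ (or_introl erefl)).
(* The new chain starts after index [n]: groundness of the right-hand side at [n] first concerns the
   left-hand side at [n.+1]. *)
exists (fun i => (extend_sdp tau (c (n.+1 + i)).1, (c (n.+1 + i)).2)).
split; last by move=> i u _; exact: cc.2.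
split=> i _; last by rewrite addnS; exact: cc.1.2.
have [_ sub [_ phi]] := cc.1.1 (n.+1 + i) isT; split=> //=.
  by exists (c (n.+1 + i)).1.
split=> // x [|]; first exact: GL.
by rewrite addSn; apply: groundS; exact: GT.
Qed.

(** Entailment quantifies over substitutions by values, whereas a chain only provides ground theory
    terms; each of these is replaced by the value with the same interpretation. *)
Lemma value_substitution sigma (L : set (var sg)) :
  substitution sigma -> L `<=` theory_sorted ->
  (forall x, L x -> ground_theory_term (sigma x)) ->
  exists2 tau, substitution tau & forall x, L x -> value (tau x) /\
    forall A (a : carrier A), denote (sigma x) a <-> denote (tau x) a.
Proof.
move=> sub Lth GL.
have /choice[tau tauP] x : exists v, has_type v (vtype x) /\ (L x -> value v /\
    forall A (a : carrier A), denote (sigma x) a <-> denote v a).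
  have [Lx|nLx] := pselect (L x); last by exists (sigma x); split.
  have [S thS xS] := Lth x Lx.
  have := sub x; rewrite xS => /(denote_total (GL x Lx))[a xa].
  have [v vv va] := value_total a thS; exists v.
  split; first exact: denote_typed va.
  move=> _; split=> // B b; split.
    move=> xb; have E := denote_unique xa xb.
    have E1 := congr1 (@projT1 _ _) E; rewrite /= in E1; subst B.
    by rewrite -(existT_inj E).
  move=> vb; have E := denote_unique va vb.
  have E1 := congr1 (@projT1 _ _) E; rewrite /= in E1; subst B.
  by rewrite -(existT_inj E).
by exists tau => x; have [] := tauP x.
Qed.

Lemma FV_subst sigma t x :
  FV (subst sigma t) x -> exists2 y, FV t y & FV (sigma y) x.
Proof.
elim: t => [f|f|y|s IHs u IHu] //=; first by exists y.
move=> [/IHs|/IHu] [y yt xy]; exists y => //; [left|right] => //.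
Qed.

(** The argument types hidden in the two applications are recovered from the unique type at which
    [f] is interpreted. *)
Lemma denote_binary f (S S' T : sort_of sg) (g : dom S -> dom S' -> dom T) s t
    (b : dom T) :
  interp_as f (g : carrier (Arr (Base S) (Arr (Base S') (Base T)))) ->
  denote (apps (Fun f) [:: s; t]) (b : carrier (Base T)) ->
  exists (a : dom S) (a' : dom S'), [/\ denote s (a : carrier (Base S)),
    denote t (a' : carrier (Base S')) & b = g a a'].
Proof.
move=> fg /denoteP[A' [h [a' [/denoteP[A [k [a [/denoteP fk sa hE]]]] ta' bE]]]].
have E := interp_as_unique fg fk.
have E1 := congr1 (@projT1 _ _) E; case: E1 => ? ?; subst A A'.
by exists a, a'; split=> //; rewrite bE hE (existT_inj E).
Qed.

Lemma holds_geq (Z : int_theory sg) s t : holds (geq_term Z s t) ->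
  exists a b : dom (intsort Z), [/\ denote s (a : carrier (Base (intsort Z))),
    denote t (b : carrier (Base (intsort Z))) & (toint b <= toint a)%R].
Proof.
move=> [e de te]; have [g ig gE] := geq_symE Z.
have [a [b [sa tb eE]]] := denote_binary ig de.
by exists a, b; split=> //; rewrite -gE -eE.
Qed.

Lemma holds_gt (Z : int_theory sg) s t : holds (gt_term Z s t) ->
  exists a b : dom (intsort Z), [/\ denote s (a : carrier (Base (intsort Z))),
    denote t (b : carrier (Base (intsort Z))) & (toint b < toint a)%R].
Proof.
move=> [e de te]; have [g ig gE] := gt_symE Z.
have [a [b [sa tb eE]]] := denote_binary ig de.
by exists a, b; split=> //; rewrite -gE -eE.
Qed.

Lemma holds_and (Z : int_theory sg) s t :
  holds (and_term Z s t) -> holds s /\ holds t.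
Proof.
move=> [e de te]; have [g ig gE] := and_symE Z.
have [a [b [sa tb eE]]] := denote_binary ig de.
by move: te; rewrite eE gE => /andP[ta tb']; split; [exists a | exists b].
Qed.

Lemma denote_zero (Z : int_theory sg) (a : dom (intsort Z)) :
  denote (Fun (zero_sym Z)) (a : carrier (Base (intsort Z))) -> toint a = 0%R.
Proof.
move=> /denoteP za; have [z iz <-] := zero_symE Z.
by rewrite (existT_inj (interp_as_unique za iz)).
Qed.

Lemma denote_base_unique t (S : sort_of sg) (a b : dom S) :
  denote t (a : carrier (Base S)) -> denote t (b : carrier (Base S)) -> a = b.
Proof. by move=> ta tb; exact: existT_inj (denote_unique ta tb). Qed.

Lemma int_value_FV (Z : int_theory sg) P X J f ts u (L : set (var sg)) :
  integer_mapping Z P X J -> heads P f -> int_value P X J f ts u ->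
  (forall i t, FI P f i -> onth ts i = Some t -> FV t `<=` L) -> FV u `<=` L.
Proof.
move=> JP hf [tau [tauE ->]] FVL x /FV_subst[y yJ xy].
have [_ _ FVJ] := JP f hf; have [i FIi Xi] := FVJ y yJ.
by apply: (FVL i (tau y)) xy => //; rewrite -Xi; exact: tauE.
Qed.

(** Both terms instantiate the same [J f], so it suffices to compare interpretations at its formal
    variables. *)
Lemma int_value_denote (Z : int_theory sg) P X J f ts us u v sigma sigma' :
  integer_mapping Z P X J -> heads P f ->
  int_value P X J f ts u -> int_value P X J f us v ->
  (forall i s t, FI P f i -> onth ts i = Some s -> onth us i = Some t ->
     forall A (a : carrier A), denote (subst sigma s) a -> denote (subst sigma' t) a) ->
  forall A (a : carrier A), denote (subst sigma u) a -> denote (subst sigma' v) a.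
Proof.
move=> JP hf [tau [tauE ->]] [tau' [tauE' ->]] H; rewrite !subst_comp.
apply: denote_subst => y yJ; have [_ _ FVJ] := JP f hf.
have [i FIi <-] := FVJ y yJ.
exact: (H i _ _ FIi (tauE i FIi) (tauE' i FIi)).
Qed.

(** Only the larger element has to be nonnegative: a descent may end in a negative integer, below
    which there is nothing. *)
Lemma int_descent_wf : well_founded (fun b a : int => (0 <= a)%R && (b < a)%R).
Proof.
have nonneg (n : nat) : Acc (fun b a : int => (0 <= a)%R && (b < a)%R) (n%:Z)%R.
  have [k] := ubnP n; elim: k n => [n|k IH n nk]; first by rewrite ltn0.
  constructor=> -[m|m] /andP[_ mn].
    rewrite ltnS in nk; apply: IH; apply: leq_trans nk.
    by rewrite -ltz_nat.
  by constructor=> b /andP[].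
by move=> [n|n]; [exact: nonneg | constructor=> b /andP[]].
Qed.

Lemma integer_mapping_sound (Z : int_theory sg) proc :
  integer_mapping_processor R Z proc -> sound R I proc.
Proof.
move=> procP P Q dpP /(procP _ _ dpP)[P' [X [J [subP _ [_ JP] ori ->]]]] fin [c cc].
have inf := infinitely_often (fin _ erefl) cc.
have Pc i : P (c i).1 by have [] := cc.1.1 i isT.
have hf i : heads P (sdp_f (c i).1) by exists (c i).1; [|left].
have hg i : heads P (sdp_g (c i).1) by exists (c i).1; [|right].
(* The components of [y i] interpret [J] on the two sides of the pair at index [i], instantiated by
   the substitution of the chain. *)
have /choice[y yP] i : exists y : dom (intsort Z) * dom (intsort Z),
    [/\ exists2 u, int_value P X J (sdp_f (c i).1) (sdp_ss (c i).1) u &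
          denote (subst (c i).2 u) (y.1 : carrier (Base (intsort Z))),
        exists2 v, int_value P X J (sdp_g (c i).1) (sdp_ts (c i).1) v &
          denote (subst (c i).2 v) (y.2 : carrier (Base (intsort Z))),
        (toint y.2 <= toint y.1)%R
      & P' (c i).1 -> (0 <= toint y.1)%R && (toint y.2 < toint y.1)%R].
  have [u [v [uJ vJ gt ge]]] := ori _ (Pc i).
  have [_ sub [GL phi]] := cc.1.1 i isT.
  have [_ _ _ FVphi Lth] := dpP _ (Pc i).
  have [tau subt tauP] := value_substitution sub Lth GL.
  have uL : FV u `<=` sdp_L (c i).1.
    apply: int_value_FV JP (hf i) uJ _ => j t [_ FIj] tj.
    by have [] := FIj _ t (Pc i) (or_introl (conj erefl tj)).
  have vL : FV v `<=` sdp_L (c i).1.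
    apply: int_value_FV JP (hg i) vJ _ => j t [_ FIj] tj.
    by have [] := FIj _ t (Pc i) (or_intror (conj erefl tj)).
  have phit : holds (subst tau (sdp_phi (c i).1)).
    case: phi => b db tb; exists b => //.
    by apply: denote_subst db => x /FVphi /tauP[_ xE] A a /xE.
  (* Entailment is applied to the value substitution [tau]; the resulting interpretations are
     carried back to the original substitution. *)
  have back t (a : dom (intsort Z)) : FV t `<=` sdp_L (c i).1 ->
      denote (subst tau t) (a : carrier (Base (intsort Z))) ->
      denote (subst (c i).2 t) (a : carrier (Base (intsort Z))).
    by move=> tL; apply: denote_subst => x /tL /tauP[_ xE] A b /xE.
  have ent psi : entails (sdp_phi (c i).1) psi -> FV psi `<=` sdp_L (c i).1 ->
      holds (subst tau psi).
    move=> /(_ tau subt) + psiL; apply=> // x [/FVphi|/psiL] Lx.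
      exact: (tauP x Lx).1.
    exact: (tauP x Lx).1.
  have [P'c|nP'c] := pselect (P' (c i).1).
    have := ent _ (gt P'c); case.
      by move=> x [[[]|[[[]|/uL]|[]]]|[[[]|/uL]|/vL]].
    move=> e de te; have /holds_and[] :
        holds (and_term Z (geq_term Z (subst tau u) (Fun (zero_sym Z)))
                          (gt_term Z (subst tau u) (subst tau v))) by exists e.
    move=> /holds_geq[a [z [ua /denote_zero z0 za]]].
    move=> /holds_gt[a' [b [ua' vb ba]]].
    have Ea := denote_base_unique ua ua'; subst a'.
    exists (a, b); split; [exists u | exists v | exact: ltW | rewrite -z0 za] => //.
      exact: back.
    exact: back.
  have := ent _ (ge nP'c); case.
    by move=> x [[[]|/uL]|/vL].
  move=> e de te; have /holds_geq[a [b [ua vb ba]]] :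
    holds (geq_term Z (subst tau u) (subst tau v)) by exists e.
  exists (a, b); split=> //; [exists u | exists v] => //; exact: back.
pose x i := toint (y i).1.
(* The arguments at positions in [FI] are ground theory terms after instantiation, so the linking
   reduction leaves the integer unchanged. *)
have xS i : toint (y i).2 = x i.+1.
  have [_ [v vJ vy] _ _] := yP i; have [[u uJ uy] _ _ _] := yP i.+1.
  have [fg args] := chain_link lcR i cc.1; congr (toint _).
  rewrite -fg in uJ; apply: denote_base_unique uy.
  apply: (int_value_denote JP (hg i) vJ uJ) vy => j s t FIj sj tj A a.
  have [s'] := args _ _ tj; rewrite sj => -[<-] st.
  apply: (steps_ground_theory lcR st _).2; case: FIj => _ /(_ _ s (Pc i)).
  move=> /(_ (or_intror (conj erefl sj)))[ths FVs].
  by apply: ground_theory_subst => // z /FVs; have [_ _ [+ _]] := cc.1.1 i isT; apply.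
apply: (@no_infinite_descent _ (fun a b : int => (b <= a)%R)
  (fun a b : int => (0 <= a)%R && (b < a)%R) x).
- move=> s t u ts /andP[t0 ut]; apply: t_step.
  by rewrite (le_trans t0 ts) (lt_le_trans ut ts).
- exact: int_descent_wf.
- by move=> i; left; apply: rt_step; rewrite -xS; have [] := yP i.
- move=> n; have [m nm P'm] := inf n; exists m => //; exists (x m.+1).
    by rewrite -xS; have [_ _ _] := yP m; apply.
  exact: rt_refl.
Qed.
End TheoryProcessors.

(** * Normal forms of calculation and reduction pairs *)

Section ReductionPairs.
Context {sg : signature} (R : set (rule sg)) (lcR : lcstrs R).
Context (I : sort_of sg -> set (term sg)).
Local Notation carrier := (carrier (@dom sg)).
Local Notation lift := (@Defs.lift sg).
Implicit Types (P : set (sdp sg)) (c : nat -> sdp sg * (var sg -> term sg)).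
Implicit Types (s t u v w l r : term sg) (sigma tau : var sg -> term sg).

(** Innermost evaluation with a classical choice of the root reduct, which [calc_root_unique] shows
    to be unique. A single contraction at the root suffices because its result is a value. *)
Fixpoint calc_normal_form t : term sg :=
  if t is App s u then
    let w := App (calc_normal_form s) (calc_normal_form u) in
    if pselect (exists v, calc_root w v) is left h then projT1 (cid h) else w
  else t.
Local Notation nf := calc_normal_form.

Lemma nf_app s u :
  calc_root (App (nf s) (nf u)) (nf (App s u)) \/
  (forall v, ~ calc_root (App (nf s) (nf u)) v) /\
    nf (App s u) = App (nf s) (nf u).
Proof.
rewrite /=; case: pselect => [h|nh]; first by left; exact: (projT2 (cid h)).
by right; split=> // v wv; apply: nh; exists v.
Qed.

Lemma calc_root_value l v : calc_root l v -> value v.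
Proof. by case. Qed.

Lemma calc_root_theory l v : calc_root l v -> theory_term l.
Proof.
case=> f vs {}v A a thf _ vals _ _ _; have : theory_term (Fun f) by [].
elim: vals (Fun f) => [|u us uval _ IH] //= s ths; apply: IH => /=; split=> //.
by case: (value_ground uval).
Qed.

(** Values have base type, so a redex denotes an element of a sort and never a function; this
    separates redexes from partial applications. *)
Lemma calc_root_denote l v : calc_root l v -> exists (S : sort_of sg) (a : dom S),
  denote l (a : carrier (Base S)) /\ denote v (a : carrier (Base S)).
Proof.
case=> f vs {}v A a _ _ _ vv la va; have [S _ [b vb]] := value_denote vv.
exists S, b; split=> //; have E := denote_unique va vb.
have E1 := congr1 (@projT1 _ _) E; rewrite /= in E1; subst A.
by rewrite -(existT_inj E).
Qed.

Lemma calc_root_unique l v w : calc_root l v -> calc_root l w -> v = w.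
Proof.
move=> lv lw; have [S [a [la va]]] := calc_root_denote lv.
have [T [b [lb wb]]] := calc_root_denote lw; have E := denote_unique la lb.
have [E1] := congr1 (@projT1 _ _) E; subst T.
rewrite -(existT_inj E) in wb.
exact: value_unique (calc_root_value lv) (calc_root_value lw) va wb.
Qed.

Lemma value_nf v : value v -> nf v = v.
Proof. by case=> f [S [-> _ _]]. Qed.

Lemma calc_app_inv s u w : calc (App s u) w ->
  [\/ calc_root (App s u) w, exists s', calc s s' | exists u', calc u u'].
Proof.
move=> /calcP[[|D u'|u' D] [l [r [lr]]]] /=.
- by move=> -> ->; constructor 1.
- move=> [-> _] _; constructor 2; exists (fill D r); apply/calcP.
  by exists D, l, r.
- move=> [_ ->] _; constructor 3; exists (fill D r); apply/calcP.
  by exists D, l, r.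
Qed.

Lemma calc_is_app s t : calc s t -> exists s0 s1, s = App s0 s1.
Proof.
move=> /calcP[[|D u|u D] [l [r [[f vs v A a _ vs0 _ _ _ _] -> _]]]] /=.
- by case/lastP: vs vs0 => // vs u _; rewrite apps_rcons; exists (apps (Fun f) vs), u.
- by eexists; eexists.
- by eexists; eexists.
Qed.

Lemma nf_calc_nf t : calc_nf t (nf t).
Proof.
split.
  elim: t => [f|f|x|s IHs u IHu]; try exact: rt_refl.
  have: clos_refl_trans (term sg) calc (App s u) (App (nf s) (nf u)).
    apply: rt_trans (App (nf s) u) _ _ _.
      elim: IHs => [a b ab|a|a b d _ ab _ bd].
      - apply: rt_step; exact: (fill_calc (CAppl (@Hole sg) u) ab).
      - exact: rt_refl.
      - exact: rt_trans ab bd.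
    elim: IHu => [a b ab|a|a b d _ ab _ bd].
    - apply: rt_step; exact: (fill_calc (CAppr (nf s) (@Hole sg)) ab).
    - exact: rt_refl.
    - exact: rt_trans ab bd.
  have [red st|[_ ->] //] := nf_app s u; apply: rt_trans st _.
  apply: rt_step; apply/calcP; exists (@Hole sg).
  by do 2!eexists; split; first exact: red.
elim: t => [f|f|x|s IHs u IHu] u'; try by move=> /calc_is_app[? []].
have [/calc_root_value[f [S [-> _ _]]]|[nored ->]] := nf_app s u.
  by move=> /calc_is_app[? []].
by move=> /calc_app_inv[/nored //|[s' /IHs]|[u'' /IHu]].
Qed.

Lemma Forall_rcons (T : Type) (p : T -> Prop) xs x :
  List.Forall p (rcons xs x) -> List.Forall p xs /\ p x.
Proof.
elim: xs => [|y xs IH] /= H; inversion H; subst; first by split.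
by have [? ?] := IH H3; split=> //; constructor.
Qed.

(* A prefix of a redex denotes a function, hence no value: it is irreducible. *)
Lemma nf_partial f us A B (g : carrier (Arr A B)) : List.Forall value us ->
  denote (apps (Fun f) us) g -> nf (apps (Fun f) us) = apps (Fun f) us.
Proof.
move: A B g; elim/last_ind: us => [|us u IH] A B g; first by [].
move=> vals; have [vus vu] := Forall_rcons vals.
rewrite apps_rcons => dg; have [A' [h [a [dh _ _]]]] := denoteP dg.
have E1 := IH _ _ _ vus dh; have E2 := value_nf vu.
have := nf_app (apps (Fun f) us) u; rewrite E1 E2.
case=> [lv|[_ ->//]]; have [S [b [lb _]]] := calc_root_denote lv.
by have := congr1 (@projT1 _ _) (denote_unique lb dg).
Qed.

(** The function part of a redex is normal by [nf_partial] and its last argument is a value, so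
    evaluation contracts exactly the root. *)
Lemma nf_root l v : calc_root l v -> nf l = v.
Proof.
move=> lv; have [S [a [la _]]] := calc_root_denote lv.
suff [s [u [Es [El1 El2]]]] : exists s u, l = App s u /\ nf s = s /\ nf u = u.
  have := nf_app s u; rewrite El1 El2 -Es.
  by case=> [/(calc_root_unique lv)|[/(_ v lv)]].
case: lv la => f us _ _ _ _ us0 vals _ _ _; case/lastP: us us0 vals => // us u _.
move=> vals; have [vus vu] := Forall_rcons vals; rewrite apps_rcons => la.
exists (apps (Fun f) us), u; split=> //; split; last exact: value_nf.
by have [A [g [b [dg _ _]]]] := denoteP la; exact: nf_partial dg.
Qed.

(** Since [nf] is computed from the normal forms of immediate subterms, invariance at the root
    extends to all contexts, with no separate confluence argument. *)
Lemma nf_calc s t : calc s t -> nf s = nf t.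
Proof.
move=> /calcP[C [l [r [lr -> ->]]]]; elim: C => [|D IH u|u D IH] /=.
- by rewrite (nf_root lr) value_nf //; exact: calc_root_value lr.
- by rewrite IH.
- by rewrite IH.
Qed.

(** Redexes are theory terms, so calculation never erases a symbol outside the theory. *)
Lemma nf_not_theory t : ~ theory_term t -> ~ theory_term (nf t).
Proof.
elim: t => [f|f|x|s IHs u IHu] // nth.
have nth' : ~ theory_term (App (nf s) (nf u)).
  move=> /= [ths thu]; apply: nth; split; apply: contrapT.
    by move=> /IHs; apply.
  by move=> /IHu; apply.
by have [/calc_root_theory|[_ ->]] := nf_app s u.
Qed.

Lemma calcs_typed M s t T : clos_refl_trans (term sg) calc s t ->
  typed M s T -> typed M t T.
Proof.
elim=> {s t} [s t /calc_typed|//|s t u _ IH1 _ IH2]; first exact.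
by move=> /IH1 /IH2.
Qed.

Lemma nf_typed M t T : typed M t T -> typed M (nf t) T.
Proof. by apply: calcs_typed; case: (nf_calc_nf t). Qed.

(** * Reduction steps as weak steps between normal forms *)

Section Monotonic.
Context (sqgeq : term sg -> term sg -> Prop) (sq_mono : monotonic R sqgeq).
Context (sq_calc : forall s t, xterm R s -> calc s t -> sqgeq s t).

(* Monotonicity only applies to typed terms, so the type is carried along. *)
Definition typed_rel T s t : Prop :=
  [/\ has_xtype R s T, has_xtype R t T & sqgeq s t].

Lemma typed_rel_fill C s t T U :
  (forall u, has_xtype R u T -> has_xtype R (fill C u) U) ->
  clos_refl_trans (term sg) (typed_rel T) s t ->
  clos_refl_trans (term sg) (typed_rel U) (fill C s) (fill C t).
Proof.
move=> CU; elim=> {s t} [s t [sT tT st]|s|s t u _ IH1 _ IH2].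
- apply: rt_step; split; [exact: CU | exact: CU | apply: sq_mono => //].
    by exists U; exact: CU.
  by exists U; exact: CU.
- exact: rt_refl.
- exact: rt_trans IH1 IH2.
Qed.

(** At most one calculation at the root separates the two terms, and [sq_calc] makes it a weak
    step. *)
Lemma typed_rel_nf_app s u T : has_xtype R (App s u) T ->
  clos_refl_trans (term sg) (typed_rel T) (App (nf s) (nf u)) (nf (App s u)).
Proof.
move=> suT; have [red|[_ ->]] := nf_app s u; last exact: rt_refl.
have wT : has_xtype R (App (nf s) (nf u)) T.
  by have [U sU uU] := typedP suT; exact: typed_app (nf_typed sU) (nf_typed uU).
have wc : calc (App (nf s) (nf u)) (nf (App s u)).
  by apply/calcP; exists (@Hole sg); do 2!eexists; split; first exact: red.
apply: rt_step; split=> //; first exact: calc_typed wT.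
by apply: sq_calc => //; exists T.
Qed.

Context (sq_rules : forall rho sigma, R rho -> substitution sigma ->
  respects_rule sigma rho ->
  sqgeq (nf (subst sigma (lhs rho))) (nf (subst sigma (rhs rho)))).

(* A left-hand side contains a symbol outside the theory, and so does every term
   around it, hence normalisation of the context commutes with plugging it in. *)
Lemma nf_rule C rho sigma T : R rho -> substitution sigma ->
  respects_rule sigma rho -> has_xtype R (fill C (subst sigma (lhs rho))) T ->
  clos_refl_trans (term sg) (typed_rel T)
    (nf (fill C (subst sigma (lhs rho)))) (nf (fill C (subst sigma (rhs rho)))).
Proof.
move=> Rr sub resp; set l := subst _ _; set r := subst _ _.
have [T0 lT0 rT0] := rule_inst_typed (defined R) (lcR Rr) sub.
have nth D : ~ theory_term (fill D l).
  by move=> /theory_term_fill; exact: lhs_not_theory (lcR Rr).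
have nf_fill s u : ~ theory_term (App s u) -> nf (App s u) = App (nf s) (nf u).
  move=> su; have [/calc_root_theory [ths thu]|[_ ->//]] := nf_app s u.
  exfalso; apply: su; split; apply: contrapT => /nf_not_theory; exact.
elim: C T => [|D IH u|u D IH] T lT.
- apply: rt_step; split; first exact: nf_typed.
    by apply: nf_typed; rewrite (typed_unique lT lT0).
  exact: sq_rules.
- have [U DU uU] := typedP lT.
  rewrite [fill _ l]/= nf_fill; last exact: (nth (CAppl D u)).
  (* On the right normalisation need not commute with the context: a theory term [r] may create a
     redex around it, and contracting that redex is a further weak step. *)
  apply: rt_trans (typed_rel_nf_app (s := fill D r) (u := u) _).
    apply: (typed_rel_fill (C := CAppl (@Hole sg) (nf u))) (IH _ DU) => v vU.
    by apply: typed_app vU _; exact: nf_typed.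
  apply: typed_app uU.
  have [V lV HV] := typed_fill DU; apply: HV.
  by rewrite (typed_unique lV lT0).
- have [U uU DU] := typedP lT.
  rewrite [fill _ l]/= nf_fill; last exact: (nth (CAppr u D)).
  apply: rt_trans (typed_rel_nf_app (s := u) (u := fill D r) _).
    apply: (typed_rel_fill (C := CAppr (nf u) (@Hole sg))) (IH _ DU) => v vU.
    by apply: typed_app vU; exact: nf_typed.
  apply: typed_app uU _.
  have [V lV HV] := typed_fill DU; apply: HV.
  by rewrite (typed_unique lV lT0).
Qed.

Lemma nf_steps s t T : has_xtype R s T -> steps R s t ->
  clos_refl_trans (term sg) sqgeq (nf s) (nf t).
Proof.
move=> sT st; suff [] : has_xtype R t T /\
  clos_refl_trans (term sg) sqgeq (nf s) (nf t) by [].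
elim: st sT => {s t} [s t st|s|s t u _ IH1 _ IH2] sT.
- split; first exact: step_typed st sT.
  case: st sT => [C rho sigma Rr sub resp sT|{}s {}t /nf_calc -> _].
    by apply: clos_rt_mono (nf_rule Rr sub resp sT) => a b [].
  exact: rt_refl.
- by split=> //; exact: rt_refl.
- have [tT st] := IH1 sT; have [uT tu] := IH2 tT.
  by split=> //; exact: rt_trans tu.
Qed.
End Monotonic.

Lemma reduction_pair_sound proc :
  reduction_pair_processor R proc -> sound R I proc.
Proof.
move=> procP P Q dpP /(procP _ _ dpP)[P' [geq [gt [[subP _] crp ori [weak rules] ->]]]].
case: crp => _ _ [sqgeq [sqgt [_ [cov1 cov2] [_ mono cal] wf compat]]] fin [c cc].
have inf := infinitely_often (fin _ erefl) cc.
have Pc i : P (c i).1 by have [] := cc.1.1 i isT.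
have sq_rules rho sigma : R rho -> substitution sigma ->
    respects_rule sigma rho ->
    sqgeq (nf (subst sigma (lhs rho))) (nf (subst sigma (rhs rho))).
  move=> Rr sub [vals phi]; apply: cov1 (rules _ Rr) _ sub _ _ _ _ _.
  (* Values are ground theory terms, so a substitution respecting the rule also respects its
     constrained quadruple. *)
  - by split=> // x /vals /value_ground.
  - exact: nf_calc_nf.
  - exact: nf_calc_nf.
pose x i := nf (subst (c i).2 (sdp_lhs (c i).1)).
pose y i := nf (subst (c i).2 (sdp_rhs (c i).1)).
have xy_gt i : P' (c i).1 -> sqgt (x i) (y i).
  move=> /ori rel; have [_ sub resp] := cc.1.1 i isT.
  by apply: cov2 rel _ sub resp _ _ _ _; exact: nf_calc_nf.
have xy_ge i : ~ P' (c i).1 -> sqgeq (x i) (y i).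
  move=> nP'; have [_ sub resp] := cc.1.1 i isT.
  by apply: cov1 (weak _ (conj (Pc i) nP')) _ sub resp _ _ _ _; exact: nf_calc_nf.
(* The link between consecutive pairs becomes weak steps on normal forms; the typing needed for
   monotonicity comes from the right-hand side having type [dp]. *)
have yx i : clos_refl_trans (term sg) sqgeq (y i) (x i.+1).
  apply: (nf_steps mono cal sq_rules _ (cc.1.2 i isT)).
  have [_ sub _] := cc.1.1 i isT; have [_ rT _ _ _] := dpP _ (Pc i).
  exact: typed_subst rT.
apply: (@no_infinite_descent _ sqgeq sqgt x compat).
- exact: wf.
- move=> i; have [/xy_gt|/xy_ge] := pselect (P' (c i).1); [right | left].
    by exists (y i).
  by apply: rt_trans (yx i); exact: rt_step.
- by move=> n; have [m nm /xy_gt] := inf n; exists m => //; exists (y m).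
Qed.

End ReductionPairs.

Theorem theorem27 (sg : signature) (R : set (rule sg))
    (ge : sort_of sg -> sort_of sg -> Prop) (C : sort_of sg -> set (term sg)) :
  lcstrs R ->
  sort_ordering ge ->
  computability_rc_set R ge C ->
  (forall proc : processor sg, graph_processor R proc -> sound R C proc) /\
  (forall proc : processor sg,
     subterm_criterion_processor R proc -> sound R C proc) /\
  (forall (Z : int_theory sg) (proc : processor sg),
     integer_mapping_processor R Z proc -> sound R C proc) /\
  (forall proc : processor sg,
     theory_argument_processor R proc -> sound R C proc) /\
  (forall proc : processor sg,
     reduction_pair_processor R proc -> sound R C proc).
Proof.
move=> lcR _ [rcC _]; split; first by move=> proc; exact: graph_sound.
split; first by move=> proc; exact: subterm_criterion_sound.
split; first by move=> Z proc; exact: integer_mapping_sound.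
split=> proc; first exact: theory_argument_sound.
exact: reduction_pair_sound.
Qed.
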